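(* Let $X$ be a nowhere locally compact, completely metrizable space and let $\kappa\geq\omega$ be an infinite cardinal. Then $\varrho(X)$ is homeomorphic to $\varrho({}^{\omega}\kappa)$ if and only if $X$ is of uniform cellularity $\kappa$.
   Context: For a Tychonoff space $X$, $\beta X$ is its Čech–Stone compactification and $X^\ast=\beta X\setminus X$. A point $p\in X^\ast$ is a remote point of $X$ if $p\notin \mathrm{cl}_{\beta X}(A)$ for every nowhere dense subset $A$ of $X$. $\varrho(X)$ denotes the set of remote points of $X$, with the subspace topology from $\beta X$. A space is nowhere locally compact if none of its points has a compact neighborhood. ${}^{\omega}\kappa$ is the countable power of the discrete space of size $\kappa$ with the product topology. The cellularity $c(X)$ is the supremum of the cardinalities of pairwise disjoint families of non-empty open subsets of $X$. $X$ is of uniform cellularity $\kappa$ if $c(X)=\kappa$ and $c(U)=\kappa$ for every non-empty open $U\subset X$. *)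

(* Defs.v *)
From HB Require Import structures.
From mathcomp Require Import all_boot all_order all_algebra.
From mathcomp Require Import all_classical all_reals all_analysis.

Set Implicit Arguments.
Unset Strict Implicit.
Unset Printing Implicit Defensive.

Import Order.TTheory GRing.Theory Num.Theory.
Import numFieldNormedType.Exports.
Local Open Scope classical_set_scope.
Local Open Scope card_scope.
Local Open Scope ring_scope.

Definition homeomorphic (X Y : topologicalType) : Prop :=
  exists (f : X -> Y) (g : Y -> X),
    [/\ continuous f, continuous g, cancel f g & cancel g f].

(* [completeType] and [cvg] require a pointed type, which would exclude the
   empty space. *)
Definition completely_metrizable (R : realType) (X : topologicalType) : Prop :=
  exists M : metricType R,
    (forall F : set_system M, ProperFilter F -> cauchy F -> exists x : M, F --> x) /\
    homeomorphic X M.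

Definition nowhere_locally_compact (X : topologicalType) : Prop :=
  forall x : X, ~ exists2 C : set X, nbhs x C & compact C.

Definition nowhere_dense (X : topologicalType) (A : set X) : Prop :=
  interior (closure A) = set0.

Section StoneCech.
Variables (R : realType) (X : topologicalType).

Definition unit_function : choiceType :=
  set_type [set f : X -> R | continuous f /\ forall x, 0 <= f x <= 1].

Definition sc_cube : topologicalType :=
  prod_topology (fun _ : unit_function => R : topologicalType).

Definition sc_eval (x : X) : sc_cube := fun f => set_val f x.

(* Čech's construction: the closure of the image of [X] in [0,1]^C(X,[0,1]);
   the ambient product is taken over R, in which [0,1]^C(X,[0,1]) is closed. *)
Definition stone_cech : topologicalType := set_type (closure (range sc_eval)).

Definition sc_embed (x : X) : stone_cech :=
  SigSub (mem_set (subset_closure (imageT sc_eval x))).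

Definition remote_point (p : stone_cech) : Prop :=
  ~ range sc_embed p /\
  forall A : set X, nowhere_dense A -> ~ closure (sc_embed @` A) p.

Definition remote : topologicalType := set_type [set p | remote_point p].

End StoneCech.

(* The space ^omega kappa, where kappa is the cardinality of [K]. *)
Definition baire_space (K : choiceType) : topologicalType :=
  prod_topology (fun _ : nat => discrete_topology K : topologicalType).

Definition cellular_family (X : topologicalType) (F : set (set X)) : Prop :=
  (forall U, F U -> open U /\ U !=set0) /\ trivIset F id.

(* c(X) = |K|: the cardinality of [K] is the least upper bound of those of the
   cellular families of [X]. *)
Definition has_cellularity (X : topologicalType) (K : Type) : Prop :=
  (forall F : set (set X), cellular_family F -> F #<= [set: K]) /\
  (forall L : Type,
     (forall F : set (set X), cellular_family F -> F #<= [set: L]) ->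
     [set: K] #<= [set: L]).

Definition uniform_cellularity (X : topologicalType) (K : Type) : Prop :=
  has_cellularity X K /\
  forall U : set X, open U -> U !=set0 -> has_cellularity (set_type U) K.

(* Main.v *)
Require Import Defs.
From HB Require Import structures.
From mathcomp Require Import all_boot all_order all_algebra.
From mathcomp Require Import all_classical all_reals all_analysis.
From mathcomp Require Import finmap wochoice lra.

Set Implicit Arguments.
Unset Strict Implicit.
Unset Printing Implicit Defensive.

Import Order.TTheory GRing.Theory Num.Theory.
Import numFieldNormedType.Exports.
Local Open Scope classical_set_scope.
Local Open Scope card_scope.
Local Open Scope ring_scope.

(** Both spaces of remote points are compared through trees of open sets.

    If [f : Z -> X] is a closed irreducible surjection onto a normal space, its
    extension to the compactifications restricts to a homeomorphism between the
    sets of remote points: images and preimages of nowhere dense sets are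
    nowhere dense, and two disjoint closed sets have images meeting in a nowhere
    dense set.  When [X] is completely metrizable, nowhere locally compact and
    of uniform cellularity [K], every non-empty open set contains a disjoint,
    locally finite, densely covering family of exactly [K] small non-empty open
    sets (Stone's theorem, plus a comparison of cardinals).  Iterating gives a
    tree indexed by finite sequences of [K], and sending a branch to the point
    it converges to is such a map from [K ^ nat] onto [X].

    Conversely, open sets of [X] and of its space of remote points determine
    disjoint families of the same sizes as soon as every non-empty open subset
    of [X] traps a remote point.  Such points come from van Douwen's argument:
    each nowhere dense set [A] is assigned closed sets missing it such that any
    [n] of the [n]-th ones meet. *)

(** * Cardinal arithmetic *)

(** Cellularity is a supremum that need not a priori be attained, whereas the tree needs exactly [K]
    children at every node. In a metric space countably many levels of cells bound every disjoint
    family, so the delicate case is a supremum of countably many smaller numbers. An infinite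
    uniformly discrete sequence inside the open set then lets each level of cells be moved into a
    region of its own. Such a sequence exists in every non-empty open set: otherwise the set would
    be totally bounded, with compact closure by completeness. The same sequence produces remote
    points. Van Douwen's closed sets are only [n]-linked, for each fixed [n]; putting the [n]-th
    ones into the [n]-th region gives unions that are closed and have the finite intersection
    property. The children of a node are only dense in it, so several branches may converge to one
    point. Local finiteness of the children keeps the branch map closed, and disjointness of nodes
    of equal length makes it irreducible. *)

Definition inj_le (A B : Type) : Prop := exists f : A -> B, injective f.

Lemma inj_le_trans (B A C : Type) : inj_le A B -> inj_le B C -> inj_le A C.
Proof. by move=> [f fi] [g gi]; exists (g \o f); exact: inj_comp. Qed.

Lemma card_le_inj (T U : Type) (A : set T) (B : set U) :
  A #<= B <-> inj_le (set_type A) (set_type B).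
Proof.
split=> [/card_leP[f]|[f fi]].
  by exists f => a b fab; apply: (inj (f := f)) fab; exact/mem_set.
by apply/card_leP/injfunPex; exists f => // a b _ _; exact: fi.
Qed.

Lemma inj_le_setT (A : Type) : inj_le A (set_type [set: A]).
Proof.
exists (fun a => SigSub (mem_set (I : [set: A] a))) => a b.
by move/(congr1 val).
Qed.

Lemma setT_inj_le (A : Type) : inj_le (set_type [set: A]) A.
Proof. by exists val; exact: val_inj. Qed.

Lemma card_le_setTP (A B : Type) : [set: A] #<= [set: B] <-> inj_le A B.
Proof.
split=> [/card_le_inj h|h].
  exact: inj_le_trans (inj_le_setT A) (inj_le_trans h (setT_inj_le B)).
apply/card_le_inj.
exact: inj_le_trans (setT_inj_le A) (inj_le_trans h (inj_le_setT B)).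
Qed.

Lemma card_le_TP (T B : Type) (A : set T) :
  A #<= [set: B] <-> inj_le (set_type A) B.
Proof.
split=> [/card_le_inj h|h]; first exact: inj_le_trans h (setT_inj_le B).
by apply/card_le_inj; exact: inj_le_trans h (inj_le_setT B).
Qed.

(** A graph instead of a function, so that Zorn's lemma applies to unions of chains. *)
Definition partial_inj (A B : Type) (G : set (A * B)) : Prop :=
  forall p q, G p -> G q -> (p.1 = q.1 <-> p.2 = q.2).

Lemma partial_inj_bigcup (A B : Type) (F : set (set (A * B))) :
  (forall G, F G -> partial_inj G) -> total_on F subset ->
  partial_inj (\bigcup_(G in F) G).
Proof.
move=> FP tot p q [G FG Gp] [H FH Hq].
have [GH|HG] := tot _ _ FG FH; first exact: (FP _ FH) (GH _ Gp) Hq.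
exact: (FP _ FG) Gp (HG _ Hq).
Qed.

Lemma partial_inj_le (A B : Type) (G : set (A * B)) : partial_inj G ->
  (forall a, exists b, G (a, b)) -> inj_le A B.
Proof.
move=> Gi tot; pose f a := projT1 (cid (tot a)).
have Gf a : G (a, f a) by rewrite /f; case: cid.
by exists f => a b fab; exact/(Gi _ _ (Gf a) (Gf b)).
Qed.

(** A maximal partial injection is total on one side: otherwise a pair of unmatched elements could
    be added. *)
Lemma inj_le_total (A B : Type) : inj_le A B \/ inj_le B A.
Proof.
have [|M [Mi Mmax]] := @Zorn_bigcup (A * B)%type (@partial_inj A B).
  by move=> F; exact: partial_inj_bigcup.
have [tot|/existsNP[a aM]] := pselect (forall a, exists b, M (a, b)).
  by left; exact: partial_inj_le tot.
have [tot|/existsNP[b bM]] := pselect (forall b, exists a, M (a, b)).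
  right; apply: (@partial_inj_le _ _ [set p | M (p.2, p.1)]) => //.
  by move=> p q Mp Mq /=; have [h1 h2] := Mi _ _ Mp Mq; split.
exfalso; apply: (Mmax (M `|` [set (a, b)])).
  split; first by move=> x; left.
  by move=> /(_ (a, b)) h; apply: aM; exists b; apply: h; right.
move=> [p1 p2] [q1 q2] [Mp|[-> ->]] [Mq|[-> ->]] //=; first exact: (Mi _ _ Mp Mq).
- by split=> e; subst; [case: aM; exists p2|case: bM; exists p1].
- by split=> e; subst; [case: aM; exists q2|case: bM; exists q1].
Qed.

Lemma nat_pair_inj : inj_le (nat * nat)%type nat.
Proof. by apply/card_le_setTP; rewrite (card_le_eql card_nat2). Qed.

Lemma infinite_inj (K : Type) : infinite_set [set: K] <-> inj_le nat K.
Proof. by rewrite infiniteP card_le_setTP. Qed.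

Section Square.
Variable K : Type.
Hypothesis Kinf : inj_le nat K.

(** The domain is read off the diagonal; [pairing] then makes [G] the graph of an injection of the
    square of [dom G] into [dom G]. *)
Let dom (G : set (K * K * K)) : set K := [set x | exists y, G ((x, x), y)].

Let pairing (G : set (K * K * K)) : Prop :=
  [/\ partial_inj G,
      forall p, G p -> [/\ dom G p.1.1, dom G p.1.2 & dom G p.2] &
      forall x y, dom G x -> dom G y -> exists z, G ((x, y), z)].

Let domS G H : G `<=` H -> dom G `<=` dom H.
Proof. by move=> GH x [y Gy]; exists y; exact: GH. Qed.

(* [S] is the domain of a maximal partial pairing function: a copy of [S] in its
   complement could absorb the three new blocks of the square. *)
Lemma infinite_pairing : exists2 S : set K, inj_le nat (set_type S) &
  inj_le (set_type S * set_type S)%type (set_type S) /\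
  ~ inj_le (set_type S) (set_type (~` S)).
Proof.
have [nu nuI] := Kinf; have [pi piI] := nat_pair_inj.
pose G0 : set (K * K * K) :=
  [set p | exists i j, p = ((nu i, nu j), nu (pi (i, j)))].
have domG0 i : dom G0 (nu i) by exists (nu (pi (i, i))); exists i, i.
have PG0 : pairing G0.
  split.
  - move=> _ _ [i [j ->]] [k [l ->]] /=; split=> [[/nuI -> /nuI ->]//|].
    by move=> /nuI/piI[-> ->].
  - by move=> _ [i [j ->]] /=; split; exact: domG0.
  - move=> _ _ [_ [i [i' [-> _ _]]]] [_ [j [j' [-> _ _]]]].
    by exists (nu (pi (i, j))); exists i, j.
(* Containing [G0], which makes the domain infinite, is asked of non-empty graphs only, because the
   union of the empty chain is empty. *)
have [|M [[PM M0] Mmax]] := @Zorn_bigcup _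
    [set G | pairing G /\ (G !=set0 -> G0 `<=` G)].
  move=> F FP tot; split; last first.
    move=> [p [G FG Gp]]; apply: subset_trans (bigcup_sup FG).
    by apply: (FP _ FG).2; exists p.
  split.
  - by apply: partial_inj_bigcup => // G /FP[[]].
  - move=> p [G FG Gp]; have [[_ h _] _] := FP _ FG.
    by have [h1 h2 h3] := h _ Gp; split; apply: domS (bigcup_sup FG) _ _.
  - move=> x y [x' [G FG Gx]] [y' [H FH Hy]].
    have [GH|HG] := tot _ _ FG FH.
      have [[_ _ h] _] := FP _ FH.
      have [z Hz] := h x y (ex_intro _ x' (GH _ Gx)) (ex_intro _ y' Hy).
      by exists z; exists H.
    have [[_ _ h] _] := FP _ FG.
    have [z Hz] := h x y (ex_intro _ x' Gx) (ex_intro _ y' (HG _ Hy)).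
    by exists z; exists G.
have {}M0 : G0 `<=` M.
  have [M_eq|/set0P/M0//] := eqVneq M set0.
  exfalso; apply: (Mmax G0); last by split=> [|_]; [exact: PG0|exact: subset_refl].
  rewrite M_eq; split=> // h.
  by apply: (h ((nu 0%N, nu 0%N), nu (pi (0%N, 0%N)))); exists 0%N, 0%N.
pose S := dom M.
have SnuT i : S (nu i) by apply: (domS M0).
have Sinf : inj_le nat (set_type S).
  by exists (fun i => SigSub (mem_set (SnuT i))) => i j /(congr1 val)/nuI.
case: PM => Mi Msub Mtot.
have MS (x y : set_type S) : exists z : set_type S, M ((val x, val y), val z).
  have [z Mz] := Mtot _ _ (set_valP x) (set_valP y).
  by have [_ _ Sz] := Msub _ Mz; exists (SigSub (mem_set Sz)).
pose c xy := projT1 (cid (MS xy.1 xy.2)).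
have Mc x y : M ((val x, val y), val (c (x, y))) by rewrite /c; case: cid.
have cI : injective c.
  move=> [x y] [x' y'] e.
  have [_ /(_ (congr1 val e)) /= []] := Mi _ _ (Mc x y) (Mc x' y').
  by move=> /val_inj -> /val_inj ->.
exists S => //; split; first by exists c.
move=> [g gI].
have [nu' nu'I] := Sinf.
pose bt (i : bool) := nu' i.
have btI : injective bt by move=> [] [] /nu'I.
(* [u false] runs over [S] and [u true] over its copy by [g] in the complement; [q] below codes the
   two tags of a block and two points of [S] by one element of [S]. *)
pose u (i : bool) (a : set_type S) : K := if i then val (g a) else val a.
have Su i a : S (u i a) <-> i = false.
  case: i; split=> //=; last by move=> _; exact: set_valP.
  by move=> h; case: (set_valP (g a)).
have uI i j a b : u i a = u j b -> i = j /\ a = b.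
  move=> e; have ij : i = j.
    have h1 := Su i a; have h2 := Su j b; move: h1 h2; rewrite e => h1 h2.
    case: i j h1 h2 {e} => [] [] //= h1 h2.
    - by apply/h1/h2.
    - by apply/esym/h2/h1.
  split=> //; subst j; case: i e => /= /val_inj //; exact: gI.
pose q i j a b := c (c (bt i, bt j), c (a, b)).
have qI i j a b i' j' a' b' : q i j a b = q i' j' a' b' ->
    [/\ i = i', j = j', a = a' & b = b'].
  by move=> /cI[/cI[/btI -> /btI ->] /cI[-> ->]].
pose N := [set p | exists i j a b,
  i || j /\ p = ((u i a, u j b), val (g (q i j a b)))].
apply: (Mmax (M `|` N)).
  split; first by move=> x; left.
  move=> /(_ ((u true (nu' 0%N), u true (nu' 0%N)),
              val (g (q true true (nu' 0%N) (nu' 0%N))))) h.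
  have /Msub[/= /(Su true) //] : M ((u true (nu' 0%N), u true (nu' 0%N)),
              val (g (q true true (nu' 0%N) (nu' 0%N)))).
  by apply: h; right; exists true, true, (nu' 0%N), (nu' 0%N).
split; last by move=> _; apply: subset_trans M0 _; left.
have SMN i a : dom (M `|` N) (u i a).
  case: i; last by apply: domS (set_valP a) => x; left.
  by exists (val (g (q true true a a))); right; exists true, true, a, a.
have domMN x : dom (M `|` N) x -> exists i a, x = u i a.
  move=> [y [My|[i [j [a [b [_ [-> _]]]]]]]]; last by exists i, a.
  have Sx : S x by exists y.
  by exists false, (SigSub (mem_set Sx)).
split.
- have MN p r : M p -> N r -> p.1 = r.1 <-> p.2 = r.2.
    move=> Mp [i [j [a [b [ij ->]]]]]; have [h1 h2 h3] := Msub _ Mp.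
    split=> /= e; last first.
      by move: h3; rewrite e => /(Su true (q i j a b)).
    by move: h1 h2 ij; rewrite e /= => /Su -> /Su ->.
  move=> p r [Mp|Np] [Mr|Nr]; first exact: Mi.
  - exact: MN.
  - by split=> e; apply/esym/(MN _ _ Mr Np).
  - case: Np => i [j [a [b [_ ->]]]]; case: Nr => i' [j' [a' [b' [_ ->]]]] /=.
    split=> [[/uI[-> ->] /uI[-> ->]]//|/val_inj/gI/qI[-> -> -> ->]//].
- move=> p [Mp|[i [j [a [b [_ ->]]]]]].
    by have [h1 h2 h3] := Msub _ Mp; split; apply: (@domS M) => // x; left.
  by split=> //=; apply: (SMN true).
- move=> x y /domMN[i [a ->]] /domMN[j [b ->]].
  case ij: (i || j).
    by exists (val (g (q i j a b))); right; exists i, j, a, b.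
  case: i j ij => [] [] // _.
  by exists (val (c (a, b))); left; exact: Mc.
Qed.

(** By comparability the complement of [S] embeds in [S], so [K] embeds in two tagged copies of [S],
    hence in [S], whose square embeds in [S]. *)
Lemma infinite_square : inj_le (K * K)%type K.
Proof.
have [S Sinf [[c cI] nS]] := infinite_pairing.
have [//|[h hI]] := inj_le_total (set_type S) (set_type (~` S)).
have [nu nuI] := Sinf.
have KS : inj_le K (set_type S).
  have tag x : exists a, (exists Sx : S x, a = c (nu 0%N, SigSub (mem_set Sx))) \/
      (exists Sx : (~` S) x, a = c (nu 1%N, h (SigSub (mem_set Sx)))).
    have [Sx|Sx] := pselect (S x).
      by exists (c (nu 0%N, SigSub (mem_set Sx))); left; exists Sx.
    by exists (c (nu 1%N, h (SigSub (mem_set (Sx : (~` S) x))))); right; exists Sx.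
  exists (fun x => projT1 (cid (tag x))) => x y.
  case: cid => /= a [] [Sx ->]; case: cid => /= b [] [Sy ->].
  - by move=> /cI[].
  - by move=> /cI[/nuI].
  - by move=> /cI[/nuI].
  - by move=> /cI[/hI[]].
have [k kI] := KS.
exists (fun xy => val (c (k xy.1, k xy.2))) => -[x y] [x' y'] /=.
by move=> /val_inj/cI[/kI -> /kI ->].
Qed.

(** The length is stored beside the nested pairs, since the fold alone need not distinguish lists of
    different lengths. *)
Lemma infinite_seq_inj : inj_le (seq K) K.
Proof.
have [c cI] := infinite_square; have [nu nuI] := Kinf.
pose code s := foldr (fun x y => c (x, y)) (nu 0%N) s.
exists (fun s => c (nu (size s), code s)) => s t /cI[/nuI].
elim: s t => [|x s IH] [|y t] //= [/IH{}IH] /cI[-> /IH ->] //.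
Qed.

Lemma infinite_nat_prod : inj_le (nat * K)%type K.
Proof.
have [nu nuI] := Kinf; apply: inj_le_trans infinite_square.
by exists (fun p => (nu p.1, p.2)) => -[i x] [j y] /= [/nuI -> ->].
Qed.

(** Lets a family indexed by [K] absorb at most [K] further members and still be indexed by exactly
    [K]. *)
Lemma infinite_sum_bij (J : Type) : inj_le J K ->
  exists f : K -> K + J, bijective f.
Proof.
move=> [h hI]; have [c cI] := infinite_square; have [nu nuI] := Kinf.
have le1 : [set: K] #<= [set: K + J].
  by apply/card_le_setTP; exists inl => x y [].
have le2 : [set: K + J] #<= [set: K].
  apply/card_le_setTP.
  exists (fun s => match s with inl x => c (nu 0%N, x) | inr y => c (nu 1%N, h y) end).
  by move=> [x|x] [y|y] /cI[] => [->|/nuI|/nuI|/hI ->].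
have /card_bijP[f [g fK gK]] := Cantor_Bernstein le1 le2.
pose up (T : Type) (x : T) : set_type [set: T] := SigSub (mem_set (I : [set: T] x)).
exists (fun x => val (f (up _ x))); exists (fun y => val (g (up _ y))).
  by move=> x; have -> : up _ (val (f (up _ x))) = f (up _ x)
    by [exact: val_inj]; rewrite fK.
by move=> y; have -> : up _ (val (g (up _ y))) = g (up _ y)
  by [exact: val_inj]; rewrite gK.
Qed.

End Square.

(** * Locally finite families and metrics *)

Lemma set_neq0P (T : Type) (A : set T) : A <> set0 -> A !=set0.
Proof. by move=> /eqP/set0P. Qed.

Lemma closure_open_meets (X : topologicalType) (A O : set X) : open O ->
  closure A `&` O !=set0 -> A `&` O !=set0.
Proof.
by move=> oO [x [clA Ox]]; apply: clA; exact: open_nbhs_nbhs.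
Qed.

Lemma closed_subset_closure (X : topologicalType) (A B : set X) :
  closed B -> A `<=` B -> closure A `<=` B.
Proof. by move=> /closure_id {2}-> /closureS. Qed.

Section LocallyFinite.
Variables (X : topologicalType) (I : choiceType).
Implicit Types (D : set I) (V : I -> set X).

(** Indices are counted rather than sets; [D] lets one labelling, such as the nodes of a tree, serve
    many subfamilies. *)
Definition locally_finite D V : Prop := forall x : X,
  exists2 G, nbhs x G & finite_set [set i | D i /\ V i `&` G !=set0].

Lemma locally_finite_sub D D' V V' : D' `<=` D ->
  (forall i, D' i -> V' i `<=` V i) ->
  locally_finite D V -> locally_finite D' V'.
Proof.
move=> DD VV lf x; have [G xO fO] := lf x; exists G => //.
apply: sub_finite_set fO => i [Di [y [Vy Oy]]]; split; first exact: DD.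
by exists y; split=> //; exact: VV.
Qed.

Lemma locally_finite_open D V x : locally_finite D V ->
  exists2 G, open_nbhs x G & finite_set [set i | D i /\ V i `&` G !=set0].
Proof.
move=> /(_ x)[G]; rewrite nbhsE => -[G' xO' G'G] fO; exists G' => //.
by apply: sub_finite_set fO => i [Di [y [Vy Oy]]]; split=> //; exists y; split=> //; exact: G'G.
Qed.

Lemma locally_finite_closure D V :
  locally_finite D V -> locally_finite D (fun i => closure (V i)).
Proof.
move=> lf x; have [G [oO Ox] fO] := locally_finite_open x lf.
exists G; first exact: open_nbhs_nbhs.
by apply: sub_finite_set fO => i [Di /(closure_open_meets oO)].
Qed.

Lemma closure_locally_finite D V : locally_finite D V ->
  closure (\bigcup_(i in D) V i) `<=` \bigcup_(i in D) closure (V i).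
Proof.
move=> lf x xV; have [G xO fO] := lf x.
have clF : closed (\bigcup_(i in [set i | D i /\ V i `&` G !=set0]) closure (V i)).
  by apply: closed_bigcup => // i _; exact: closed_closure.
suff : (\bigcup_(i in [set i | D i /\ V i `&` G !=set0]) closure (V i)) x.
  by move=> [i [Di _] Vi]; exists i.
apply: clF => N xN; have [y [[i Di Vy] [Ny Oy]]] := xV _ (filterI xN xO).
exists y; split=> //; exists i; last exact: subset_closure.
by split=> //; exists y.
Qed.

Lemma closed_locally_finite D V : locally_finite D V ->
  (forall i, D i -> closed (V i)) -> closed (\bigcup_(i in D) V i).
Proof.
move=> lf cl x /(closure_locally_finite lf)[i Di /(cl i Di) Vx].
by exists i.
Qed.

End LocallyFinite.

Section Metric.
Variables (R : realType) (X : topologicalType).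

(** The metric is a function on a space that keeps its own topology, so that remote points are
    formed from the same space throughout. *)
Record compatible_metric (d : X -> X -> R) : Prop := CompatibleMetric {
  dist_ge0 : forall x y, 0 <= d x y;
  distxx : forall x, d x x = 0;
  dist_eq0 : forall x y, d x y = 0 -> x = y;
  dist_sym : forall x y, d x y = d y x;
  dist_triangle : forall y x z, d x z <= d x y + d y z;
  dist_nbhs : forall x A,
    nbhs x A <-> exists2 e, 0 < e & [set y | d x y < e] `<=` A }.

Definition complete_metric (d : X -> X -> R) : Prop :=
  forall F : set_system X, ProperFilter F ->
    (forall e : R, 0 < e -> exists x : X, F [set y | d x y < e]) ->
  exists x : X, F --> x.

Lemma completely_metrizable_metric : completely_metrizable R X ->
  exists2 d, compatible_metric d & complete_metric d.
Proof.
move=> [M [Mc [f [g [fc gc fK gK]]]]].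
exists (fun x y => mdist (f x) (f y)).
  split=> //.
  - by move=> x y; exact: mdist_ge0.
  - by move=> x; exact: mdistxx.
  - by move=> x y /mdist_positivity/(can_inj fK).
  - by move=> x y; exact: metric_sym.
  - by move=> y x z; exact: metric_triangle.
  - move=> x A; split=> [xA|[e e0 eA]].
      have : nbhs (f x) (g @^-1` A) by apply: gc; rewrite fK.
      move=> /nbhs_ballP[e /= e0 eA]; exists e => // y xy.
      by rewrite -(fK y); apply: eA; rewrite ballEmdist.
    have : nbhs (f x) (ball (f x) e) by exact: nbhsx_ballx.
    move=> /fc h; apply: (@filterS _ (nbhs x) _ _ _ _ h) => y /=.
    by rewrite ballEmdist => /eA.
move=> F FF Fc; have cF : cauchy (f @ F).
  apply: cauchy_exP => e e0; have [x Fx] := Fc e e0; exists (f x).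
  suff : F (f @^-1` ball (f x) e) by [].
  by apply: (filterS _ Fx) => y xy; rewrite /preimage /= ballEmdist.
have [x Fx] := Mc (f @ F) _ cF.
exists (g x) => A xA; have /Fx h : nbhs x (g @^-1` A) by exact: gc.
by apply: (@filterS _ F _ _ _ _ h) => y /=; rewrite fK.
Qed.

Variable d : X -> X -> R.
Hypothesis dM : compatible_metric d.

Definition dball (x : X) (e : R) : set X := [set y | d x y < e].

Lemma dball_nbhs x e : 0 < e -> nbhs x (dball x e).
Proof. by move=> e0; apply/(dist_nbhs dM); exists e. Qed.

Lemma dball_center x e : 0 < e -> dball x e x.
Proof. by rewrite /dball /= (distxx dM). Qed.

Lemma dball_open x e : open (dball x e).
Proof.
rewrite openE => y /= xy; apply/(dist_nbhs dM).
exists (e - d x y); first by rewrite subr_gt0.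
move=> z /= yz; apply: (le_lt_trans (dist_triangle dM y x z)).
by rewrite -ltrBrDl.
Qed.

Lemma open_dball O x : open O -> O x -> exists2 e, 0 < e & dball x e `<=` O.
Proof.
by move=> oO Ox; apply/(dist_nbhs dM); exact: open_nbhs_nbhs.
Qed.

Lemma dist_closure_ball x e y : closure (dball x e) y -> d x y <= e.
Proof.
move=> xy; rewrite leNgt; apply/negP => exy.
have [|z [/= xz yz]] := xy (dball y (d x y - e)).
  by apply: dball_nbhs; rewrite subr_gt0.
have := dist_triangle dM z x y; rewrite (dist_sym dM z y) leNgt.
by rewrite -(subrK e (d x y)) addrC ltrD.
Qed.

Lemma metric_normal : normal_space X.
Proof.
apply/(@normal_openP R) => A B clA clB AB0.
have sep (D : set X) : closed D -> forall x,
    exists e, 0 < e /\ (~ D x -> dball x e `&` D = set0).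
  move=> clD x; have [Dx|nDx] := pselect (D x); first by exists 1; split.
  have [e e0 eD] := open_dball (closed_openC clD) nDx.
  by exists e; split=> // _; apply/disjoints_subset.
pose eA x := projT1 (cid (sep _ clB x)).
pose eB x := projT1 (cid (sep _ clA x)).
have eA0 x : 0 < eA x by rewrite /eA; case: cid => e [].
have eB0 x : 0 < eB x by rewrite /eB; case: cid => e [].
have eAB x y : A x -> B y -> eA x <= d x y.
  move=> Ax By; rewrite leNgt; apply/negP; rewrite /eA; case: cid => e [_ h] /= xy.
  have nBx : ~ B x by move=> Bx; have : (A `&` B) x by []; rewrite AB0.
  by have : (dball x e `&` B) y by []; rewrite h.
have eBA x y : A x -> B y -> eB y <= d x y.
  move=> Ax By; rewrite leNgt (dist_sym dM); apply/negP; rewrite /eB; case: cid => e [_ h] /= xy.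
  have nAy : ~ A y by move=> Ay; have : (A `&` B) y by []; rewrite AB0.
  by have : (dball y e `&` A) x by []; rewrite h.
(* A common point of two half-balls would make [d x y] smaller than the mean of [eA x] and [eB y],
   neither of which exceeds it. *)
exists (\bigcup_(x in A) dball x (eA x / 2)), (\bigcup_(x in B) dball x (eB x / 2)).
split.
- by apply: bigcup_open => x _; exact: dball_open.
- by apply: bigcup_open => x _; exact: dball_open.
- by move=> x Ax; exists x => //; apply: dball_center; rewrite divr_gt0.
- by move=> x Ax; exists x => //; apply: dball_center; rewrite divr_gt0.
- apply/seteqP; split=> // z [[x Ax /= xz] [y By /= yz]].
  have := dist_triangle dM z x y; have := eAB _ _ Ax By; have := eBA _ _ Ax By.
  by move: xz yz; rewrite /dball /= (dist_sym dM z y); lra.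
Qed.

Lemma metric_closed1 (x : X) : closed [set x].
Proof.
move=> y yx; apply: contrapT => xy.
have d0 : 0 < d y x.
  by rewrite lt_neqAle (dist_ge0 dM) andbT eq_sym; apply/eqP => /(dist_eq0 dM) e; apply: xy.
by have [z [/= -> ]] := yx _ (dball_nbhs y d0); rewrite /dball /= ltxx.
Qed.

Lemma nlc_point_nwd (x : X) : nowhere_locally_compact X -> nowhere_dense [set x].
Proof.
move=> nlc; rewrite /nowhere_dense -(closure_id _).1; last exact: metric_closed1.
apply/seteqP; split=> // y yx; have e := interior_subset yx.
apply: (nlc y); exists [set x]; [exact: yx | exact: compact_set1].
Qed.

End Metric.

(** * Traces of points of the Stone-Cech compactification *)

(** The basic boxes generate a filter, and its convergence to [t] can be checked one coordinate at a
    time. *)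
Lemma nbhs_power (I : eqType) (T : topologicalType)
    (t : prod_topology (fun _ : I => T)) (G : set (prod_topology (fun _ : I => T))) :
  nbhs t G -> exists s : seq I, exists2 N : I -> set T,
    (forall i, nbhs (t i) (N i)) &
    [set r : I -> T | forall i, i \in s -> N i (r i)] `<=` G.
Proof.
pose B : set_system (prod_topology (fun _ : I => T)) := fun G =>
  exists s : seq I, exists2 N : I -> set T, (forall i, nbhs (t i) (N i)) &
    [set r : I -> T | forall i, i \in s -> N i (r i)] `<=` G.
have BF : Filter B.
  split.
  - by exists [::], (fun=> setT) => // i; exact: filterT.
  - move=> G1 G2 [s1 [N1 tN1 NG1]] [s2 [N2 tN2 NG2]].
    exists (s1 ++ s2), (fun i => N1 i `&` N2 i); first by move=> i; exact: filterI.
    move=> r Nr; split; [apply: NG1|apply: NG2] => i si;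
      by have [] := Nr i _; rewrite // mem_cat si ?orbT.
  - by move=> G1 G2 G12 [s [N tN NG]]; exists s, N => // r /NG/G12.
suff : B --> t by move=> /(_ G)/[apply].
apply/cvg_sup => i A [_ [[W oW <-] /= Wt WA]].
exists [:: i], (fun j => if j == i then W else setT).
  move=> j; case: eqP => [->|_]; last exact: filterT.
  exact: open_nbhs_nbhs.
by move=> r /(_ i (mem_head _ _)); rewrite eqxx => Wr; exact: WA.
Qed.

Lemma nbhs_set_type (X : topologicalType) (A : set X) (x : set_type A)
    (B : set (set_type A)) :
  nbhs x B <-> exists2 C, open_nbhs (val x) C & val @^-1` C `<=` B.
Proof.
split=> [|[C [oC Cx] CB]].
  rewrite nbhsE => -[_ [[C oC <-] Cx] CB].
  by exists C.
by rewrite nbhsE; exists (val @^-1` C) => //; split=> //; exists C.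
Qed.

Section Trace.
Variables (R : realType) (X : topologicalType).
Local Notation bX := (stone_cech R X).
Local Notation emb := (@sc_embed R X).
Local Notation ev := (@sc_eval R X).
Implicit Types (p q : bX) (A N : set X).

Definition unit_fun (f : X -> R) (fP : continuous f /\ forall x, 0 <= f x <= 1) :
  unit_function R X := SigSub (mem_set fP).

(** The neighbourhood filter of [p] seen from [X]; it turns closures in the compactification into
    statements about subsets of [X]. *)
Definition trace p : set_system X :=
  fun N => exists2 G, nbhs (val p) G & ev @^-1` G `<=` N.

Lemma trace_proper p : ProperFilter (trace p).
Proof.
split.
  move=> [G pG G0]; have [_ [[x _ <-] Gx]] := set_valP p _ pG.
  exact: (G0 x).
split.
- by exists setT => //; exact: filterT.
- move=> N M [G pG GN] [H pH HM]; exists (G `&` H); first exact: filterI.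
  by move=> x [/GN Nx /HM Mx].
- by move=> N M NM [G pG GN]; exists G => // x /GN/NM.
Qed.

Lemma trace_filter p : Filter (trace p).
Proof. exact: (@filter_filter _ _ (trace_proper p)). Qed.

Lemma closure_traceP p A :
  closure (emb @` A) p <-> forall N, trace p N -> A `&` N !=set0.
Proof.
split=> [pA N [G pG GN]|h B /nbhs_set_type[C pC CB]].
  have pN : nbhs p (val @^-1` G).
    move: pG; rewrite nbhsE => -[C pC CG]; apply/nbhs_set_type; exists C => //.
    by move=> q; exact: CG.
  have [_ [[x Ax <-] Gx]] := pA _ pN.
  by exists x; split=> //; exact: GN.
have [|x [Ax Cx]] := h (ev @^-1` C).
  by exists C => //; exact: open_nbhs_nbhs.
by exists (emb x); split; [exists x|exact: CB].
Qed.

Lemma trace_unit p (g : unit_function R X) e : 0 < e ->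
  trace p [set x | `|set_val g x - val p g| < e].
Proof.
move=> e0; exists [set r : sc_cube R X | `|r g - val p g| < e] => //.
have := @proj_continuous _ (fun _ : unit_function R X => (R : topologicalType)) g (val p).
move=> /(_ _ (nbhsx_ballx (val p g) _ e0)) h.
by apply: (@filterS _ (nbhs (val p)) _ _ _ _ h) => r; rewrite /= /ball /= distrC.
Qed.

Lemma cube_nbhs_box (q : sc_cube R X) G : nbhs q G ->
  exists s : seq (unit_function R X), exists2 e : R, 0 < e &
    [set r : sc_cube R X | forall g, g \in s -> `|r g - q g| < e] `<=` G.
Proof.
move=> /nbhs_power[s [N qN NG]]; exists s.
suff [e e0 eN] : exists2 e : R, 0 < e & forall g, g \in s ->
    forall y, `|y - q g| < e -> N g y.
  by exists e => // r re; apply: NG => g gs; exact: eN (re g gs).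
elim: s {NG} => [|g s [e e0 IH]]; first by exists 1.
have /nbhs_ballP[e' /= e'0 e'N] := qN g.
exists (Num.min e e'); first by rewrite lt_min e0.
move=> h; rewrite inE => /orP[/eqP ->|hs] y; rewrite lt_min => /andP[ye ye'].
  by apply: e'N; rewrite /ball /= distrC.
exact: IH.
Qed.

Lemma trace_box p N : trace p N -> exists s : seq (unit_function R X),
  exists2 e : R, 0 < e &
    [set x | forall g, g \in s -> `|set_val g x - val p g| < e] `<=` N.
Proof.
move=> [G /cube_nbhs_box[s [e e0 eG]] GN]; exists s, e => // x xe.
by apply: GN; apply: eG.
Qed.

Lemma trace_all p (s : seq (unit_function R X)) e : 0 < e ->
  trace p [set x | forall g, g \in s -> `|set_val g x - val p g| < e].
Proof.
move=> e0; have pF := trace_filter p; elim: s => [|g s IH].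
  by apply: filterS filterT => x _ g.
apply: filterS (filterI (trace_unit p g e0) IH) => x [xg xs] h.
by rewrite inE => /orP[/eqP ->//|/xs].
Qed.

Lemma unit_fun_continuous (g : unit_function R X) : continuous (set_val g).
Proof. by have [] := set_valP g. Qed.

Lemma open_box (s : seq (unit_function R X)) (a : unit_function R X -> R) e :
  open [set x : X | forall g, g \in s -> `|set_val g x - a g| < e].
Proof.
rewrite openE => x; elim: s => [|g s IH] xs; first by apply: filterS filterT.
have /IH {}IH : forall h, h \in s -> `|set_val h x - a h| < e.
  by move=> h hs; apply: xs; rewrite inE hs orbT.
have xg : nbhs (set_val g x) (ball (a g) e).
  apply: open_nbhs_nbhs; split; first exact: ball_open.
  by have := xs g (mem_head _ _); rewrite /ball /= distrC.
apply: (@filterS _ (nbhs x) _ _ _ _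
  (@filterI _ (nbhs x) _ _ _ (unit_fun_continuous xg) IH)) => y [yg ys] h.
rewrite inE => /orP[/eqP ->|/ys//].
by move: yg; rewrite /= /ball /= distrC.
Qed.

Lemma closed_box (s : seq (unit_function R X)) (a : unit_function R X -> R) e :
  closed [set x : X | forall g, g \in s -> `|set_val g x - a g| <= e].
Proof.
have -> : [set x : X | forall g, g \in s -> `|set_val g x - a g| <= e] =
    \bigcap_(g in [set g | g \in s]) (set_val g @^-1` [set y | `|y - a g| <= e]).
  by apply/seteqP; split=> x h g; exact: h.
apply: closed_bigI => g _; apply: preimage_closed.
  by move=> x _; exact: unit_fun_continuous.
have -> : [set y : R | `|y - a g| <= e] = [set y | a g - e <= y] `&` [set y | y <= a g + e].
  by apply/seteqP; split=> y /=; rewrite ler_distl => /andP.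
by apply: closedI; [exact: closed_ge|exact: closed_le].
Qed.

Lemma trace_closed p N : trace p N -> exists2 C, closed C & trace p C /\ C `<=` N.
Proof.
move=> /trace_box[s [e e0 eN]].
exists [set x : X | forall g, g \in s -> `|set_val g x - val p g| <= e / 2].
  exact: closed_box.
have e20 : 0 < e / 2 by rewrite divr_gt0.
split.
  have pF := trace_filter p; apply: filterS (trace_all p s e20) => x h g gs.
  exact/ltW/h.
move=> x h; apply: eN => g gs; apply: le_lt_trans (h g gs) _.
by rewrite ltr_pdivrMr// ltr_pMr// ltr1n.
Qed.

Lemma trace_disjoint p A : ~ closure (emb @` A) p ->
  exists2 C, closed C & trace p C /\ A `&` C = set0.
Proof.
move=> /closure_traceP/existsNP[N /not_implyP[pN NA]].
have [C clC [pC CN]] := trace_closed pN; exists C => //; split=> //.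
apply/seteqP; split=> // x [Ax Cx]; apply: NA; exists x; split=> //; exact: CN.
Qed.

Lemma trace_closure p N : trace p N -> closure (emb @` N) p.
Proof.
move=> pN; apply/closure_traceP => M pM; have pF := trace_proper p.
exact: (filter_ex (filterI pN pM)).
Qed.

Lemma trace_disjointW p A N : trace p N -> A `&` N = set0 -> ~ closure (emb @` A) p.
Proof. by move=> pN AN0 /closure_traceP/(_ N pN); rewrite AN0 => -[]. Qed.

Lemma closure_embS p A B : A `<=` B -> closure (emb @` A) p -> closure (emb @` B) p.
Proof. by move=> AB; apply: closureS => _ [x /AB Bx <-]; exists x. Qed.

(** A Urysohn function is a coordinate of the cube, and the value of [p] there cannot be within
    [1 / 2] of both [0] and [1]. *)
Lemma normal_disjoint p A B : normal_space X -> closed A -> closed B ->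
  A `&` B = set0 -> ~ (closure (emb @` A) p /\ closure (emb @` B) p).
Proof.
move=> /(@normal_separatorP R) nX clA clB AB0 [/closure_traceP pA /closure_traceP pB].
have /(@uniform_separatorP _ R)[f [cf f01 fA fB]] := nX _ _ clA clB AB0.
have fu : continuous f /\ forall x, 0 <= f x <= 1.
  split=> // x; have : range f (f x) by exists x.
  by move=> /f01; rewrite /= in_itv.
have e0 : (0 : R) < 1 / 2 by lra.
have pN := trace_unit p (unit_fun fu) e0.
have [x [Ax /= xp]] := pA _ pN; have [y [By /= yp]] := pB _ pN.
have fx : f x = 0 by apply: (fA (f x)); exists x.
have fy : f y = 1 by apply: (fB (f y)); exists y.
have {}xp : `|f x - val p (unit_fun fu)| < 1 / 2 by exact: xp.
have {}yp : `|f y - val p (unit_fun fu)| < 1 / 2 by exact: yp.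
by move: xp yp; rewrite fx fy !ltr_distl; lra.
Qed.

(** If some closed [C] of the trace missed [A]&[B], the disjoint closed sets [A]&[C] and [B]&[C]
    would both have [p] in their closure. *)
Lemma normal_closureI p A B : normal_space X -> closed A -> closed B ->
  closure (emb @` A) p -> closure (emb @` B) p -> closure (emb @` (A `&` B)) p.
Proof.
move=> nX clA clB pA pB; apply: contrapT => /trace_disjoint[C clC [pC AB0]].
apply: (@normal_disjoint p (A `&` C) (B `&` C) nX); [exact: closedI|exact: closedI| |].
  by apply/seteqP; split=> // x [[Ax Cx] [Bx _]]; have : (A `&` B `&` C) x by []; rewrite AB0.
have pF := trace_filter p.
split; apply/closure_traceP => N pN.
  move/closure_traceP: pA => /(_ _ (filterI pC pN))[x [Ax [Cx Nx]]].
  by exists x.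
move/closure_traceP: pB => /(_ _ (filterI pC pN))[x [Ax [Cx Nx]]].
by exists x.
Qed.

(** Compactness in the form in which it is used: Tychonoff's theorem applied to the image of a
    filter on [X]. *)
Lemma stone_cech_cluster (F : set_system X) : ProperFilter F ->
  exists p : bX, forall N M, F N -> trace p M -> N `&` M !=set0.
Proof.
move=> FF.
have cK : compact [set f : sc_cube R X | forall g, `[0, 1]%classic (f g)].
  apply: (@tychonoff _ (fun _ : unit_function R X => R) (fun=> `[0, 1]%classic)) => g.
  exact: segment_compact.
have [|q [_ qF]] := cK (ev @ F) _.
  suff : F (ev @^-1` [set f : sc_cube R X | forall g, `[0, 1]%classic (f g)]) by [].
  apply: filterS filterT => x _ g /=; have [_ /(_ x)] := set_valP g.
  by rewrite in_itv.
have clq : closure (range ev) q.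
  move=> G qG; have [|r [rr Gr]] := qF (range ev) G _ qG; last by exists r.
  suff : F (ev @^-1` range ev) by [].
  by apply: filterS filterT => x _; exists x.
exists (SigSub (mem_set clq)) => N M FN [G qG GM].
have [|_ [[x Nx <-] Gx]] := qF (ev @` N) G _ qG.
  suff : F (ev @^-1` (ev @` N)) by [].
  by apply: filterS FN => x Nx; exists x.
by exists x; split=> //; exact: GM.
Qed.

Lemma stone_cech_eq p q : (forall g : unit_function R X, val p g = val q g) -> p = q.
Proof. by move=> h; apply: val_inj; apply/funext => g; exact: h. Qed.


(** A point of [X] lies in the closure of its own singleton, so the second clause implies the
    first. *)
Lemma remote_pointE p : (forall x : X, nowhere_dense [set x]) ->
  remote_point p <-> forall A, nowhere_dense A -> ~ closure (emb @` A) p.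
Proof.
move=> nwd1; split=> [[]//|h]; split=> //.
move=> [x _ xp]; apply: (h [set x] (nwd1 x)).
by apply: subset_closure; exists x => //; apply: val_inj.
Qed.

End Trace.

(** * Remote points and closed irreducible maps *)

Lemma nowhere_dense_closed (X : topologicalType) (A : set X) : closed A ->
  (forall W, open W -> W !=set0 -> ~ W `<=` A) -> nowhere_dense A.
Proof.
move=> clA h; rewrite /nowhere_dense -(closure_id _).1//.
have [//|/eqP/set_neq0P W0] := eqVneq (interior A) set0.
by case: (h _ (@open_interior _ A) W0); exact: interior_subset.
Qed.

Lemma nowhere_dense_subset (X : topologicalType) (A W : set X) : nowhere_dense A ->
  open W -> W !=set0 -> ~ W `<=` closure A.
Proof.
move=> nA oW [x Wx] WA; have : interior (closure A) x.
  by rewrite (open_subsetE _ oW) in WA; exact: WA.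
by rewrite nA.
Qed.

Section RemoteNbhs.
Variables (R : realType) (X : topologicalType).
Local Notation emb := (@sc_embed R X).

Lemma nbhs_remoteP (p : remote R X) O : nbhs p O <->
  exists A : set X, [/\ closed A, ~ closure (emb @` A) (val p) &
    forall q : remote R X, ~ closure (emb @` A) (val q) -> O q].
Proof.
split=> [/nbhs_set_type[C [oC Cp] CO]|[A [clA Ap AO]]].
  have /nbhs_set_type[D [oD Dp] DC] : nbhs (val p) C by exact: open_nbhs_nbhs.
  have /cube_nbhs_box[s [e e0 eD]] : nbhs (val (val p)) D by exact: open_nbhs_nbhs.
  have e20 : 0 < e / 2 by rewrite divr_gt0.
  have e2e : e / 2 < e by rewrite ltr_pdivrMr// ltr_pMr// ltr1n.
  (* [A] misses the open half-box, which belongs to the trace of [p]. Off the closure of [A], the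
     trace of [q] has a member inside the closed half-box; the other [e / 2] pays for the passage
     from a point of [X] to [q]. *)
  pose A := closure (~` [set x | forall g, g \in s -> `|set_val g x - val (val p) g| <= e / 2]).
  have pF := trace_proper (val p).
  have pN := trace_all (val p) s e20.
  have oB : open [set x | forall g, g \in s -> `|set_val g x - val (val p) g| < e / 2].
    exact: (open_box s (val (val p))).
  exists A; split.
  - exact: closed_closure.
  - apply: (trace_disjointW pN); apply/seteqP; split=> // x [Ax Bx].
    have [y [nBy By]] := Ax _ (open_nbhs_nbhs (conj oB Bx)).
    by apply: nBy => g gs; exact/ltW/By.
  - move=> q /trace_disjoint[N clN [qN AN]]; apply: CO; apply: DC; apply: eD => g gs.
    have pFq := trace_proper (val q).
    have e40 : 0 < e / 2 by [].
    have [x [Nx /= xq]] := filter_ex (filterI qN (trace_unit (val q) g e40)).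
    have xp : `|set_val g x - val (val p) g| <= e / 2.
      apply: contrapT => nh; have : (A `&` N) x.
        by split=> //; apply: subset_closure => /(_ g gs).
      by rewrite AN.
    have -> : e = e / 2 + e / 2 by rewrite -splitr.
    rewrite (le_lt_trans (ler_distD (set_val g x) _ _))// ltr_leD// distrC//.
apply/nbhs_set_type; exists (~` closure (emb @` A)); last by move=> q; exact: AO.
by split=> //; apply: closed_openC; exact: closed_closure.
Qed.

End RemoteNbhs.

Section IrreducibleMap.
Variables (R : realType) (Z X : topologicalType) (f : Z -> X).
Hypothesis fc : continuous f.

Definition sc_pull (g : unit_function R X) : unit_function R Z.
Proof.
apply: (@unit_fun R Z (set_val g \o f)); split.
  by move=> z; apply: continuous_comp; [exact: fc|exact: unit_fun_continuous].
by move=> z; have [_] := set_valP g; apply.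
Defined.

Lemma sc_map_subproof (p : stone_cech R Z) :
  closure (range (@sc_eval R X)) (fun g => val p (sc_pull g)).
Proof.
move=> G /cube_nbhs_box[s [e e0 eG]]; have pF := trace_proper p.
have [z pz] := filter_ex (trace_all p (map sc_pull s) e0).
exists (@sc_eval R X (f z)); split; first by exists (f z).
by apply: eG => g gs; apply: (pz (sc_pull g)); exact: map_f.
Qed.

(** The extension of [f], given by composing each coordinate function with [f]. *)
Definition sc_map (p : stone_cech R Z) : stone_cech R X :=
  SigSub (mem_set (@sc_map_subproof p)).

Lemma trace_sc_map p N : trace (sc_map p) N -> trace p (f @^-1` N).
Proof.
move=> /trace_box[s [e e0 eN]]; have pF := trace_filter p.
apply: filterS (trace_all p (map sc_pull s) e0) => z pz; apply: eN => g gs.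
by apply: (pz (sc_pull g)); exact: map_f.
Qed.

Lemma closure_sc_map p A : closure (@sc_embed R Z @` A) p ->
  closure (@sc_embed R X @` (f @` A)) (sc_map p).
Proof.
move=> /closure_traceP pA; apply/closure_traceP => N /trace_sc_map/pA[z [Az Nz]].
by exists (f z); split=> //; exists z.
Qed.

Hypothesis f_closed : forall A, closed A -> closed (f @` A).
Hypothesis f_surj : forall x, exists z, f z = x.
(** Irreducibility read on fibres: no proper closed subset of [Z] maps onto [X]. *)
Hypothesis f_irr : forall W, open W -> W !=set0 -> exists x, forall z, f z = x -> W z.
Hypothesis X_normal : normal_space X.

(** A closed [C] in the trace of [p] that misses the preimage of [A] has a closed image disjoint
    from [A], and normality separates the two. *)
Lemma closure_sc_map_preimage p A : closed A ->
  closure (@sc_embed R X @` A) (sc_map p) -> closure (@sc_embed R Z @` (f @^-1` A)) p.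
Proof.
move=> clA pA; apply: contrapT => /trace_disjoint[C clC [pC AC]].
apply: (normal_disjoint X_normal clA (f_closed clC) _ (conj pA _)).
  apply/seteqP; split=> // x [+ [z Cz zx]]; rewrite -zx => Az.
  by have : (f @^-1` A `&` C) z by []; rewrite AC.
by apply: closure_sc_map; exact: trace_closure.
Qed.

(** An open [W] inside the preimage would yield the open set of points whose whole fibre lies in
    [W], non-empty by irreducibility and contained in [closure A]. *)
Lemma irreducible_preimage_nwd A : nowhere_dense A -> nowhere_dense (f @^-1` closure A).
Proof.
move=> nA; apply: nowhere_dense_closed.
  by apply: preimage_closed; [move=> z _; exact: fc|exact: closed_closure].
move=> W oW W0 WA; have [x xW] := f_irr oW W0.
apply: (@nowhere_dense_subset _ _ (~` (f @` (~` W))) nA).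
- by apply: closed_openC; apply: f_closed; exact: open_closedC.
- by exists x => -[z nWz /xW].
- move=> y Wy; have [z zy] := f_surj y; rewrite -zy; apply: WA.
  by apply: contrapT => nWz; apply: Wy; exists z.
Qed.

(** The part of the preimage of [V] outside [closure B] is open and non-empty, so it contains a
    whole fibre, whose image point [closure B] cannot reach. *)
Lemma irreducible_image_nwd B : nowhere_dense B -> nowhere_dense (f @` closure B).
Proof.
move=> nB; apply: nowhere_dense_closed; first by apply: f_closed; exact: closed_closure.
move=> V oV [x0 Vx0] VB.
have oW : open (f @^-1` V) by apply: open_comp => // z _; exact: fc.
have [z0 z0x] := f_surj x0.
have W0 : (f @^-1` V) !=set0 by exists z0; rewrite /= z0x.
have [z1 /not_implyP[Vz1 Bz1]] := (existsNP _).2 (nowhere_dense_subset nB oW W0).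
have [||x xW] := f_irr (W := f @^-1` V `&` ~` closure B).
- by apply: openI => //; apply: closed_openC; exact: closed_closure.
- by exists z1.
have [z zx] := f_surj x; have [Vz _] := xW _ zx.
by have [c Bc cz] := VB _ Vz; have [_ []] := xW c (etrans cz zx).
Qed.

(** For closed [D], an open [V] covered by the image of [D] has its whole preimage in [D]; applied
    to [A] and to [C] this contradicts their disjointness. *)
Lemma irreducible_imageI_nwd A C : closed A -> closed C -> A `&` C = set0 ->
  nowhere_dense (f @` A `&` f @` C).
Proof.
move=> clA clC AC; apply: nowhere_dense_closed; first by apply: closedI; exact: f_closed.
move=> V oV [x0 Vx0] VS.
have oW : open (f @^-1` V) by apply: open_comp => // z _; exact: fc.
have sub D : closed D -> V `<=` f @` D -> f @^-1` V `<=` D.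
  move=> clD VD z Vz; apply: contrapT => Dz.
  have [||x xW] := f_irr (W := f @^-1` V `&` ~` D).
  - by apply: openI => //; exact: closed_openC.
  - by exists z.
  have [z' zx] := f_surj x; have [Vz' _] := xW _ zx.
  by have [c Bc cz] := VD _ Vz'; have [_ []] := xW c (etrans cz zx).
have [z0 z0x] := f_surj x0.
have V0 : (f @^-1` V) z0 by rewrite /= z0x.
have : (A `&` C) z0.
  by split; [apply: (sub A)|apply: (sub C)] => //; move=> x /VS[].
by rewrite AC.
Qed.

Hypothesis Z_nwd : forall z : Z, nowhere_dense [set z].
Hypothesis X_nwd : forall x : X, nowhere_dense [set x].

Lemma remote_sc_map p : remote_point p -> remote_point (sc_map p).
Proof.
move=> /(remote_pointE p Z_nwd) rp; apply/(remote_pointE _ X_nwd) => A nA pA.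
apply: (rp _ (irreducible_preimage_nwd nA)); apply: closure_sc_map_preimage.
  exact: closed_closure.
by apply: closure_embS pA; exact: subset_closure.
Qed.

Lemma remote_sc_mapV p : remote_point (sc_map p) -> remote_point p.
Proof.
move=> /(remote_pointE _ X_nwd) rp; apply/(remote_pointE _ Z_nwd) => B nB pB.
apply: (rp _ (irreducible_image_nwd nB)); apply: closure_sc_map.
by apply: closure_embS pB; exact: subset_closure.
Qed.

(** The preimages of the trace of [q] generate a proper filter on [Z]; any of its adherent points is
    sent to [q]. *)
Lemma sc_map_surj q : exists p, sc_map p = q.
Proof.
have qF := trace_proper q.
pose F : set_system Z := fun N => exists2 M, trace q M & f @^-1` M `<=` N.
have FF : ProperFilter F.
  split.
    move=> [M /filter_ex[x Mx] M0]; have [z zx] := f_surj x.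
    by apply: (M0 z); rewrite /= zx.
  split.
  - by exists setT => //; exact: filterT.
  - move=> N1 N2 [M1 q1 M1N] [M2 q2 M2N]; exists (M1 `&` M2); first exact: filterI.
    by move=> z [/M1N ? /M2N ?].
  - by move=> N1 N2 N12 [M qM MN]; exists M => // z /MN/N12.
have [p pF] := stone_cech_cluster R FF.
exists p; apply: stone_cech_eq => g.
apply/eqP; rewrite -subr_eq0 -normr_le0; apply/ler_addgt0Pl => e e0.
rewrite addr0; have e20 : 0 < e / 2 by rewrite divr_gt0.
have Fg : F (f @^-1` [set x | `|set_val g x - val q g| < e / 2]).
  by exists [set x | `|set_val g x - val q g| < e / 2] => //; exact: trace_unit.
have [z [/= z1 z2]] := pF _ _ Fg (trace_unit p (sc_pull g) e20).
have {}z2 : `|set_val g (f z) - val (sc_map p) g| < e / 2 by exact: z2.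
have -> : e = e / 2 + e / 2 by rewrite -splitr.
by rewrite (le_trans (ler_distD (set_val g (f z)) _ _))// lerD// ltW// distrC.
Qed.

(** This makes the map one-to-one on remote points and its inverse continuous. Otherwise the image
    of [p] would be in the closure of the intersection of the images of [A] and [C], which is
    nowhere dense. *)
Lemma remote_sc_map_disjoint p A : remote_point p -> closed A ->
  ~ closure (@sc_embed R Z @` A) p -> ~ closure (@sc_embed R X @` (f @` A)) (sc_map p).
Proof.
move=> rp clA /trace_disjoint[C clC [pC AC]] pA.
have /(remote_pointE _ X_nwd) rq := remote_sc_map rp.
apply: (rq _ (irreducible_imageI_nwd clA clC AC)).
apply: normal_closureI => //; [exact: f_closed|exact: f_closed|].
by apply: closure_sc_map; exact: trace_closure.
Qed.

Lemma remote_homeomorphic : homeomorphic (remote R Z) (remote R X).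
Proof.
pose b (p : remote R Z) : remote R X :=
  SigSub (mem_set (remote_sc_map (set_valP p) : [set q | remote_point q] _)).
have ex (q : remote R X) : exists p, b p = q.
  have [p pq] := sc_map_surj (val q).
  have rp : remote_point p by apply: remote_sc_mapV; rewrite pq; exact: set_valP.
  by exists (SigSub (mem_set (rp : [set q | remote_point q] _))); apply: val_inj.
pose h q := projT1 (cid (ex q)).
have hK : cancel h b by move=> q; rewrite /h; case: cid.
have bI : injective b.
  move=> p q bpq; apply: val_inj; apply: stone_cech_eq => g; apply: contrapT => gpq.
  pose e := `|val (val p) g - val (val q) g|.
  have e0 : 0 < e / 3 by rewrite divr_gt0// normr_gt0 subr_eq0; exact/eqP.
  have [N clN [pN Ng]] := trace_closed (trace_unit (val p) g e0).
  have /(remote_sc_map_disjoint (set_valP q) clN) : ~ closure (@sc_embed R Z @` N) (val q).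
    apply: (trace_disjointW (trace_unit (val q) g e0)).
    apply/seteqP; split=> // z [/Ng /= zp /= zq].
    move: zp zq; rewrite (distrC _ (val (val p) g)) => zp zq.
    have := ler_distD (set_val g z) (val (val p) g) (val (val q) g).
    by move: zp zq; rewrite -/e; lra.
  apply; have := congr1 val bpq; rewrite /b /= => <-.
  by apply: closure_sc_map; exact: trace_closure.
have bK : cancel b h by move=> p; apply: bI; rewrite hK.
exists b, h; split=> //.
- move=> p O /nbhs_remoteP[A [clA Ap AO]]; apply/nbhs_remoteP.
  exists (f @^-1` A); split.
  + by apply: preimage_closed => // z _; exact: fc.
  + move=> pA; apply: Ap; have := closure_sc_map pA.
    by apply: closure_embS; exact: image_preimage_subset.
  + by move=> q qA; apply: AO => /(closure_sc_map_preimage clA).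
- move=> q O /nbhs_remoteP[A [clA Ap AO]]; apply/nbhs_remoteP.
  exists (f @` A); split; first exact: f_closed.
  + have := remote_sc_map_disjoint (set_valP (h q)) clA Ap.
    by have := congr1 val (hK q); rewrite /b /= => ->.
  + move=> r rA; apply: AO => hrA; apply: rA; have := closure_sc_map hrA.
    by have := congr1 val (hK r); rewrite /b /= => ->.
Qed.

End IrreducibleMap.

(** * Trees of open sets *)

(** The strict part of a well-order. Two distinct incomparable points would both be least in the
    pair they form, against uniqueness. *)
Lemma least_order (T : eqType) : exists lt : T -> T -> Prop,
  (forall P : T -> Prop, (exists x, P x) -> exists x, P x /\ forall y, lt y x -> ~ P y) /\
  forall x y, x <> y -> lt x y \/ lt y x.
Proof.
have [r rW] := well_ordering_principle T.
have least (P : T -> Prop) : (exists x, P x) -> exists x, P x /\ forall y, P y -> r x y.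
  move=> [x Px]; have [|z [[zP zmin] _]] := rW [pred x | `[< P x >]].
    by exists x; apply/asboolP.
  exists z; split; first exact/asboolP/zP.
  by move=> y Py; apply: zmin; exact/asboolP.
exists (fun y x => ~ r x y); split.
  by move=> P /least[x [Px xmin]]; exists x; split=> // y nxy /xmin.
move=> x y xy; apply: contrapT => /not_orP[/contrapT ryx /contrapT rxy].
have refl z : r z z by have [|w [-> h]] := least (eq z); [exists z|exact: h].
have [|z [_ zU]] := rW (pred2 x y); first by exists x; rewrite inE eqxx.
apply: xy; rewrite -(zU x) ?(zU y)//.
  by split; [rewrite !inE eqxx orbT|move=> w; rewrite !inE => /orP[] /eqP ->].
by split; [rewrite !inE eqxx|move=> w; rewrite !inE => /orP[] /eqP ->].
Qed.

Lemma finite_subsingleton (T : Type) (A : set T) :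
  (forall x y, A x -> A y -> x = y) -> finite_set A.
Proof.
move=> h; have [->|/eqP/set_neq0P[x Ax]] := eqVneq A set0; first exact: finite_set0.
by apply: (sub_finite_set _ (finite_set1 x)) => y /(h _ _ Ax).
Qed.

(** Near [x] only finitely many [V i] matter, and each of them costs one further neighbourhood
    [H i]. *)
Lemma locally_finite_bind (X : topologicalType) (I J : choiceType) (D : set I)
    (V : I -> set X) (E : I -> set J) (W : J -> set X) :
  locally_finite D V -> (forall i, D i -> locally_finite (E i) W) ->
  (forall i j, D i -> E i j -> W j `<=` V i) ->
  locally_finite (\bigcup_(i in D) E i) W.
Proof.
move=> lf lfE WV x; have [G xG fG] := lf x.
have ex i : exists H, nbhs x H /\ (D i -> finite_set [set j | E i j /\ W j `&` H !=set0]).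
  have [Di|nDi] := pselect (D i); last by exists setT; split=> //; exact: filterT.
  by have [H xH fH] := lfE i Di x; exists H.
pose H i := projT1 (cid (ex i)).
have HP i : nbhs x (H i) /\ (D i -> finite_set [set j | E i j /\ W j `&` H i !=set0]).
  by rewrite /H; case: cid.
set S := [set i | D i /\ V i `&` G !=set0] in fG.
exists (G `&` \bigcap_(i in [set` fset_set S]) H i).
  by apply: filterI => //; apply: filter_bigI => i _; exact: (HP i).1.
apply: (@sub_finite_set _ _ (\bigcup_(i in S) [set j | E i j /\ W j `&` H i !=set0])).
  move=> j [[i Di Eij] [y [Wy [Gy Hy]]]]; have Si : S i.
    by split=> //; exists y; split=> //; exact: WV Wy.
  exists i => //; split=> //; exists y; split=> //.
  by apply: Hy; rewrite /= in_fset_set//; exact/mem_set.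
by apply: bigcup_finite => // i [Di _]; exact: (HP i).2.
Qed.

Section Mesh.
Variable R : realType.

Definition mesh (n : nat) : R := n.+1%:R^-1.

Lemma mesh_gt0 n : 0 < mesh n.
Proof. by rewrite invr_gt0 ltr0n. Qed.

Lemma mesh_le m n : (m <= n)%N -> mesh n <= mesh m.
Proof. by move=> mn; rewrite lef_pV2 ?posrE ?ltr0n// ler_nat. Qed.

Lemma mesh_small (e : R) : 0 < e -> exists n, mesh n < e.
Proof.
move=> e0; exists (Num.bound e^-1).
rewrite invf_plt ?posrE ?ltr0n//.
have := archi_boundP (ltW (etrans (invr_gt0 e) e0)).
by move=> /lt_trans -> //; rewrite ltr_nat.
Qed.

End Mesh.

Section Tree.
Variables (R : realType) (X : topologicalType) (d : X -> X -> R).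
Hypothesis dM : compatible_metric d.
Local Notation mesh := (mesh R).

(* [U a n] is A. H. Stone's sigma-discrete refinement of the cover by balls:
   for fixed [n] its members are [mesh n] apart.  Removing from level [n] the
   closure of the earlier levels makes the family disjoint and locally finite
   while keeping its union dense. *)
Lemma stone_cells (e : R) : 0 < e -> exists W : X * nat -> set X,
  [/\ (forall i, open (W i)), (forall i j, W i `&` W j !=set0 -> i = j),
      locally_finite setT W, (forall G, open G -> G !=set0 -> exists i, G `&` W i !=set0) &
      forall i x y, W i x -> W i y -> d x y < e].
Proof.
move=> e0; have [lt [least tot]] := least_order X.
pose C a := dball d a (e / 2).
(* The factor [3]: centres for different [a] are at least [3 * mesh n] apart, and the balls of
   radius [mesh n] in [U] use up two of these three parts. *)
pose E a n := [set x | dball d x (3 * mesh n) `<=` C a /\ forall b, lt b a -> ~ C b x].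
pose U a n := \bigcup_(x in E a n) dball d x (mesh n).
have oU a n : open (U a n) by apply: bigcup_open => x _; exact: dball_open.
have UC a n : U a n `<=` C a.
  move=> y [x [xC _] xy]; apply: xC; apply: lt_le_trans xy _.
  by have := mesh_gt0 R n; lra.
have sep a b n x y : U a n x -> U b n y -> a <> b -> mesh n <= d x y.
  wlog : a b x y / lt b a.
    move=> h Ux Uy ab; have [ltab|ltba] := tot _ _ ab; last exact: (h a b).
    by rewrite (dist_sym dM); apply: (h b a) => // /esym.
  move=> ltba [u [_ uC] ux] [v [vC _] vy] _.
  have uv : 3 * mesh n <= d v u.
    by rewrite leNgt; apply/negP => vu; apply: (uC _ ltba); exact: vC.
  have := dist_triangle dM x v u; have := dist_triangle dM y v x.
  move: ux vy uv; rewrite /dball /= (dist_sym dM x u) (dist_sym dM y x); lra.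
pose Wd n := \bigcup_a U a n.
have oWd n : open (Wd n) by apply: bigcup_open.
have cover x : exists n, Wd n x.
  have [|a [Ca amin]] := least (fun a => C a x).
    by exists x; apply: dball_center => //; rewrite divr_gt0.
  have [r r0 rC] := open_dball dM (dball_open dM a (e / 2)) Ca.
  have [|n nr] := mesh_small (e := r / 3); first by rewrite divr_gt0.
  exists n, a => //; exists x; last exact/dball_center/mesh_gt0.
  split=> // y xy; apply: rC; apply: lt_trans xy _; lra.
pose W (i : X * nat) := U i.1 i.2 `&` ~` closure (\bigcup_(m in `I_i.2) Wd m).
have WU i : W i `<=` U i.1 i.2 by move=> x [].
have Wlt a b m n x : (m < n)%N -> U a m x -> ~ W (b, n) x.
  move=> mn Ux [_ /= nW]; apply: nW; apply: subset_closure; exists m => //.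
  by exists a.
exists W; split.
- by move=> i; apply: openI => //; apply: closed_openC; exact: closed_closure.
- move=> [a m] [b n] [x [Wa Wb]].
  have [mn|nm|mn] := ltngtP m n.
  + by case: (Wlt a b m n x mn (WU _ _ Wa)).
  + by case: (Wlt b a n m x nm (WU _ _ Wb)).
  + subst n; congr pair; apply: contrapT => ab.
    have := sep _ _ _ _ _ (WU _ _ Wa) (WU _ _ Wb) ab.
    by rewrite (distxx dM) leNgt mesh_gt0.
(* Levels after [n] miss [Wd n], a neighbourhood of [x]. Each earlier or equal level has at most one
   index whose set meets a ball of radius [mesh n / 2]. *)
- move=> x; have [n Wx] := cover x.
  have m20 : 0 < mesh n / 2 by rewrite divr_gt0// mesh_gt0.
  exists (Wd n `&` dball d x (mesh n / 2)).
    by apply: filterI; [apply: open_nbhs_nbhs|exact: dball_nbhs].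
  apply: (@sub_finite_set _ _ (\bigcup_(m in `I_n.+1)
      [set i | i.2 = m /\ U i.1 i.2 `&` dball d x (mesh n / 2) !=set0])).
    move=> [a m] [_ [y [Wy [[b _ Wny] xy]]]]; exists m.
      by rewrite /= ltnS leqNgt; apply/negP => nm; exact: (Wlt b a n m y).
    by split=> //; exists y; split=> //; exact: WU Wy.
  apply: bigcup_finite => [|m mn]; first exact: finite_II.
  apply: finite_subsingleton => -[a _] [b _] [/= -> [y [ay xy]]] [/= -> [z [bz xz]]].
  congr pair; apply: contrapT => ab.
  have := sep _ _ _ _ _ ay bz ab; have := dist_triangle dM x y z.
  have := @mesh_le R m n; rewrite -ltnS => /(_ mn).
  by move: xy xz; rewrite /dball /= (dist_sym dM x y); lra.
- move=> G oG [x Gx]; have [n Wx] := cover x.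
  (* At the least level that meets [G], the open set [G] misses the earlier levels and hence also
     their closure. *)
  have ex : exists n, `[< G `&` Wd n !=set0 >] by exists n; apply/asboolP; exists x.
  case: (ex_minnP ex) => m /asboolP[y [Gy [a _ ay]]] mmin.
  exists (a, m), y; split=> //; split=> // /= ycl.
  have [z [[k km Wz] Gz]] := ycl _ (open_nbhs_nbhs (conj oG Gy)).
  have /mmin : `[< G `&` Wd k !=set0 >] by apply/asboolP; exists z.
  by rewrite leqNgt km.
- move=> i x y /WU/UC xa /WU/UC ya.
  have := dist_triangle dM i.1 x y; move: xa ya; rewrite /C /dball /= (dist_sym dM x i.1); lra.
Qed.

(* Nodes are lists with the last choice first, so the children of [s] are the
   [i :: s]; nodes may be empty sets. *)
Record open_tree (I : choiceType) (V : seq I -> set X) : Prop := OpenTree {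
  tree_root : V [::] = setT;
  tree_open : forall s, open (V s);
  tree_sub : forall i s, V (i :: s) `<=` V s;
  tree_disj : forall s i j, V (i :: s) `&` V (j :: s) !=set0 -> i = j;
  tree_lf : forall s, locally_finite setT (fun i => V (i :: s));
  tree_dense : forall s G, open G -> G `&` V s !=set0 ->
    exists i, G `&` V (i :: s) !=set0;
  tree_small : forall i s x y, V (i :: s) x -> V (i :: s) y -> d x y < mesh (size s) }.

(** The number of children is not controlled here; this tree serves the existence of remote
    points. *)
Lemma exists_open_tree : exists (I : choiceType) (V : seq I -> set X), open_tree V.
Proof.
pose W n := projT1 (cid (stone_cells (mesh_gt0 R n))).
have WP n := projT2 (cid (stone_cells (mesh_gt0 R n))).
pose V := fix V (s : seq (X * nat)) : set X :=
  if s is i :: s' then W (size s') i `&` V s' else setT.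
exists (X * nat : choiceType)%type, V; split=> //.
- elim=> [|i s IH] /=; first exact: openT.
  by apply: openI => //; have [h _ _ _ _] := WP (size s); exact: h.
- by move=> i s x [].
- move=> s i j [x [[xi _] [xj _]]]; have [_ h _ _ _] := WP (size s).
  by apply: h; exists x.
- move=> s; have [_ _ h _ _] := WP (size s).
  by apply: locally_finite_sub h => // i _ x [].
- move=> s G oG GV; have [_ _ _ h _] := WP (size s).
  have [|i [x [[Gx Vx] Wx]]] := h (G `&` V s) _ GV; last by exists i, x.
  apply: openI => //; elim: s {GV h} => [|i s IH] /=; first exact: openT.
  by apply: openI => //; have [h _ _ _ _] := WP (size s); exact: h.
- by move=> i s x y [xi _] [yi _]; have [_ _ _ _ h] := WP (size s); exact: h yi.
Qed.

Section TreeTheory.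
Variables (I : choiceType) (V : seq I -> set X).
Hypothesis VT : open_tree V.

(** Siblings are disjoint, so nodes that meet are comparable and their lengths decide which contains
    the other. *)
Lemma tree_meet s t : V s `&` V t !=set0 -> (size s <= size t)%N ->
  V t `<=` V s /\ (size s = size t -> s = t).
Proof.
elim: t s => [|i t IH] s Vst.
  by rewrite leqn0 => /nilP ->; split.
rewrite leq_eqVlt => /orP[/eqP|].
  case: s Vst => [//|j s] Vst /= [st].
  have [x [/(tree_sub VT) Vs /(tree_sub VT) Vt]] := Vst.
  have st0 : V s `&` V t !=set0 by exists x.
  have [_ /(_ st) e] := IH s st0 (eq_leq st); subst s.
  by have -> := tree_disj VT Vst; split.
rewrite /= ltnS => st; split; last by move=> e; move: st; rewrite e ltnn.
apply: subset_trans (tree_sub VT (s := t) (i := i)) _.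
have [x [Vs /(tree_sub VT) Vt]] := Vst.
by apply: (IH s _ st).1; exists x.
Qed.

Lemma tree_level_lf n : locally_finite [set s | size s = n] V.
Proof.
elim: n => [|n IH].
  move=> x; exists setT; first exact: filterT.
  by apply: finite_subsingleton => s t [/= /size0nil -> _] [/size0nil -> _].
apply: (@locally_finite_sub _ _ (\bigcup_(s in [set s | size s = n]) [set i :: s | i in setT])
   _ V V).
- by move=> [//|i s] /= [sn]; exists s => //; exists i.
- by move=> s _.
apply: locally_finite_bind IH _ _ => [s sn x|s _ sn [i _ <-]]; last exact: tree_sub.
have [G xG fG] := tree_lf VT s x; exists G => //.
apply: sub_finite_set (finite_image (fun i => i :: s) fG) => _ [[i _ <-] h].
by exists i.
Qed.

Lemma tree_level_dense n G : open G -> G !=set0 ->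
  exists s, size s = n /\ G `&` V s !=set0.
Proof.
move=> oG G0; elim: n => [|n [s [sn GV]]].
  by exists [::]; split=> //; rewrite (tree_root VT) setIT.
have [i h] := tree_dense VT oG GV; exists (i :: s); split=> //=.
by rewrite sn.
Qed.

Lemma tree_shrink G n : open G -> G !=set0 ->
  exists s, [/\ (n <= size s)%N, V s !=set0 & closure (V s) `<=` G].
Proof.
move=> oG [x Gx]; have [e e0 eG] := open_dball dM oG Gx.
have e40 : 0 < e / 4 by rewrite divr_gt0.
have [m me] := mesh_small e40.
(* One level beyond [maxn n m], because [tree_small] bounds a child by the mesh at the length of its
   parent. *)
have [|s [sm [y [xy Vy]]]] := @tree_level_dense (maxn n m).+1 _ (dball_open dM x (e / 4)).
  by exists x; exact: dball_center.
exists s; split; first by rewrite sm leqW// leq_maxl.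
  by exists y.
case: s sm Vy => [//|i s] [sm] Vy.
have Vb : V (i :: s) `<=` dball d x (e / 2).
  move=> z Vz; have := tree_small VT Vy Vz; have := @mesh_le R m (size s).
  rewrite sm leq_maxr => /(_ isT); have := dist_triangle dM y x z.
  by move: xy me; rewrite /dball /=; lra.
move=> z /(closureS Vb)/(dist_closure_ball dM) xz; apply: eG.
by rewrite /dball /=; lra.
Qed.

End TreeTheory.
End Tree.

(** * Existence of remote points *)

Section Existence.
Variables (R : realType) (X : topologicalType) (d : X -> X -> R).
Hypothesis dM : compatible_metric d.
Variables (I : choiceType) (V : seq I -> set X).
Hypothesis VT : open_tree d V.

Lemma exists_missing : exists t : set X -> seq I -> seq I,
  forall A s, nowhere_dense A -> V s !=set0 ->
    [/\ (size s <= size (t A s))%N, V (t A s) !=set0, V (t A s) `<=` V s &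
        closure (V (t A s)) `&` closure A = set0].
Proof.
suff /choice[t tP] : forall As : set X * seq I, exists t,
    nowhere_dense As.1 -> V As.2 !=set0 ->
    [/\ (size As.2 <= size t)%N, V t !=set0, V t `<=` V As.2 &
        closure (V t) `&` closure As.1 = set0].
  by exists (fun A s => t (A, s)) => A s; exact: (tP (A, s)).
move=> [A s] /=.
have [nA|nA] := pselect (nowhere_dense A); last by exists s.
have [Vs|Vs] := pselect (V s !=set0); last by exists s.
have [||t [st Vt tV]] := tree_shrink dM VT (G := V s `&` ~` closure A) (size s).
- by apply: openI; [exact: (tree_open VT)|apply: closed_openC; exact: closed_closure].
- apply: contrapT => h.
  apply: (nowhere_dense_subset nA (tree_open VT s) Vs) => x Vx.
  by apply: contrapT => nAx; apply: h; exists x.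
exists t => _ _; split=> //.
  by move=> x /subset_closure/tV[].
by apply/seteqP; split=> // x [/tV[_ nAx] Ax].
Qed.

Variable t : set X -> seq I -> seq I.
Hypothesis tP : forall A s, nowhere_dense A -> V s !=set0 ->
    [/\ (size s <= size (t A s))%N, V (t A s) !=set0, V (t A s) `<=` V s &
        closure (V (t A s)) `&` closure A = set0].

(* [front r A i] is a locally finite family of nodes, dense below [r], on which
   the search for nodes missing [A] is repeated; descending to the level of
   [t A s] rather than to [t A s] itself makes nodes of different fronts
   comparable by their sizes alone. *)
Fixpoint front (r : seq I) (A : set X) (i : nat) : set (seq I) :=
  if i is j.+1 then
    \bigcup_(s in front r A j)
      [set s' | [/\ size s' = size (t A s), V s' !=set0 & V s' `<=` V s]]
  else [set r].

(** One round of search for each of the [n] sets that are to have a common point. *)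
Definition linked r A n : set X :=
  \bigcup_(i in `I_n) \bigcup_(s in front r A i) closure (V (t A s)).

Lemma front_neq0 r A i s : V r !=set0 -> front r A i s -> V s !=set0.
Proof. by move=> Vr; case: i => [->//|i [s' _ []]]. Qed.

Lemma front_sub r A i s : front r A i s -> V s `<=` V r.
Proof.
elim: i s => [s ->//|i IH s [s' /IH fs' [_ _ ss']]].
exact: subset_trans ss' fs'.
Qed.

Lemma front_lf r A i : locally_finite (front r A i) V.
Proof.
elim: i => [|i IH].
  move=> x; exists setT; first exact: filterT.
  by apply: finite_subsingleton => s s' [/= -> _] [-> _].
apply: locally_finite_bind IH _ _ => [s _|s s' _ [] //].
by apply: locally_finite_sub (tree_level_lf VT (size (t A s))) => [s' []|s' _].
Qed.

Lemma front_dense r A i G : nowhere_dense A -> V r !=set0 ->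
  open G -> G !=set0 -> G `<=` V r ->
  exists2 s, front r A i s & V s `&` G !=set0.
Proof.
move=> nA Vr oG G0 Gr; elim: i => [|i [s fs [x [Vx Gx]]]].
  by exists r => //; case: G0 => x Gx; exists x; split=> //; exact: Gr.
have Vs := front_neq0 Vr fs.
have [st _ _ _] := tP nA Vs.
have [||s' [sz [y [[Gy Vy] V'y]]]] := tree_level_dense VT (size (t A s)) (G := G `&` V s).
- by apply: openI => //; exact: (tree_open VT).
- by exists x.
exists s'; last by exists y.
exists s => //; split=> //; first by exists y.
by apply: (tree_meet VT _ _).1; [exists y|rewrite sz].
Qed.

Lemma linked_disjoint r A n : nowhere_dense A -> V r !=set0 ->
  linked r A n `&` closure A = set0.
Proof.
move=> nA Vr; apply/seteqP; split=> // x [[i _ [s fs tx]] Ax].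
have [_ _ _ h] := tP nA (front_neq0 Vr fs).
by have : (closure (V (t A s)) `&` closure A) x by []; rewrite h.
Qed.

Lemma linked_sub r A n : nowhere_dense A -> V r !=set0 ->
  linked r A n `<=` closure (V r).
Proof.
move=> nA Vr x [i _ [s fs]]; apply: closureS.
have [_ _ h _] := tP nA (front_neq0 Vr fs).
exact: subset_trans h (front_sub fs).
Qed.

Lemma linked_closed r A n : nowhere_dense A -> V r !=set0 -> closed (linked r A n).
Proof.
move=> nA Vr; apply: closed_bigcup => [|i _]; first exact: finite_II.
apply: closed_locally_finite => [|s _]; last exact: closed_closure.
apply: (@locally_finite_closure _ _ _ (fun s => V (t A s))).
apply: locally_finite_sub (@front_lf r A i) => // s fs.
by have [_ _ h _] := tP nA (front_neq0 Vr fs).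
Qed.

(** Among all sets of [As] and all nodes of their [i]-th fronts that meet [u], take the pair for
    which [t A s] is shortest and descend to that node. By minimality the nodes of the next front of
    any other set are at least as long, so those meeting [t A s] lie below it. The invariant thus
    holds again, with one set fewer and one round more. *)
Lemma linked_step r (As : seq (set X)) i u :
  (forall A, A \in As -> nowhere_dense A) -> V r !=set0 ->
  V u !=set0 -> V u `<=` V r ->
  (forall A s, A \in As -> front r A i s -> V s `&` V u !=set0 -> V s `<=` V u) ->
  exists v, [/\ V v !=set0, V v `<=` V u & forall A, A \in As ->
    exists j s, [/\ (j < i + size As)%N, front r A j s & V v `<=` V (t A s)]].
Proof.
have [k sz] : exists k, size As = k by exists (size As).
elim: k As sz i u => [|k IH] As sz i u nAs Vr Vu ur uP.
  by exists u; split=> // A; move/size0nil: sz => ->.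
pose ok A s := [/\ A \in As, front r A i s & V s `&` V u !=set0].
have ex : exists m, `[< exists A s, ok A s /\ size (t A s) = m >].
  case: As sz nAs {uP} @ok => [//|A As] _ nAs ok.
  have [s fs su] := front_dense i (nAs A (mem_head _ _)) Vr (tree_open VT u) Vu ur.
  exists (size (t A s)); apply/asboolP; exists A, s; split=> //.
  by split=> //; exact: mem_head.
case: (ex_minnP ex) => m /asboolP[A [s [[AAs fs su] szm]]] mmin.
have [st Vt ts _] := tP (nAs _ AAs) (front_neq0 Vr fs).
have tu : V (t A s) `<=` V u by apply: subset_trans ts _; exact: uP fs su.
have [||||||v [Vv vt vP]] := IH (rem A As) _ i.+1 (t A s).
- by rewrite size_rem// sz.
- by move=> B /mem_rem; exact: nAs.
- by [].
- by [].
- exact: subset_trans tu ur.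
- move=> B s' /mem_rem BAs [s'' fs'' [sz' Vs' ss']] [x [s'x tx]].
  have le : (m <= size (t B s''))%N.
    apply: mmin; apply/asboolP; exists B, s''; split=> //; split=> //.
    by exists x; split; [exact: ss'|exact: tu].
  apply: (tree_meet VT _ _).1; first by exists x.
  by rewrite szm sz'.
exists v; split=> //; first exact: subset_trans vt tu.
move=> B BAs; have [->|BA] := eqVneq B A.
  by exists i, s; split=> //; rewrite sz addnS ltnS leq_addr.
have [|j [s' [jk fs' vs']]] := vP B; first exact: rem_mem.
exists j, s'; split=> //; apply: leq_trans jk _.
by rewrite size_rem// sz /= addnS addSn.
Qed.

Lemma linked_finite_meet r (As : seq (set X)) :
  (forall A, A \in As -> nowhere_dense A) -> V r !=set0 ->
  exists x, forall A, A \in As -> linked r A (size As) x.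
Proof.
move=> nAs Vr.
have [||v [[x Vx] _ vP]] := linked_step (i := 0) (u := r) nAs Vr Vr.
- by move=> y.
- by move=> A s _ /= -> _ y.
exists x => A /vP[j [s [js fs vs]]]; exists j => //; exists s => //.
by apply: subset_closure; exact: vs.
Qed.

End Existence.

(** An infinite uniformly discrete subset of [U]; both the construction of remote points and the
    splitting of open sets start from it. *)
Definition separated_sequence (R : realType) (X : topologicalType)
    (d : X -> X -> R) (U : set X) : Prop :=
  exists2 e : R, 0 < e & exists x : nat -> X,
    (forall n, U (x n)) /\ forall m n, m <> n -> e <= d (x m) (x n).

(** Any [k] of the sets [F A] meet below [r k], so they generate a proper filter. An adherent point
    of it is in the closure of each [F A], a closed set disjoint from [closure A], hence outside the
    closure of [A]. *)
Lemma exists_remote (R : realType) (X : topologicalType) (d : X -> X -> R)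
    (U : set X) : compatible_metric d -> (forall x : X, nowhere_dense [set x]) ->
  open U -> separated_sequence d U ->
  exists p : remote R X, ~ closure (@sc_embed R X @` (~` U)) (val p).
Proof.
move=> dM nwd1 oU [e e0 [x [xU xe]]].
have [I [V VT]] := exists_open_tree dM.
have [t tP] := exists_missing dM VT.
have e40 : 0 < e / 4 by rewrite divr_gt0.
have /choice[r rP] : forall n, exists s, V s !=set0 /\
    closure (V s) `<=` U `&` dball d (x n) (e / 4).
  move=> n; have [||s [_ Vs sU]] := tree_shrink dM VT (G := U `&` dball d (x n) (e / 4)) 0.
  - by apply: openI => //; exact: dball_open.
  - by exists (x n); split=> //; exact: dball_center.
  - by exists s.
have Vr n := (rP n).1.
(* Four steps shorter than [e / 4] would join [x m] to [x n], so a ball of radius [e / 4] meets at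
   most one of the closures. *)
have rlf : locally_finite setT (fun n => closure (V (r n))).
  move=> y; exists (dball d y (e / 4)); first exact: dball_nbhs.
  apply: finite_subsingleton => m n [_ [a [ma ya]]] [_ [b [nb yb]]].
  apply: contrapT => /xe; have [_ mx] := (rP m).2 _ ma; have [_ nx] := (rP n).2 _ nb.
  have := dist_triangle dM a (x m) (x n); have := dist_triangle dM y a (x n).
  have := dist_triangle dM b y (x n).
  move: mx nx ya yb; rewrite /dball /= (dist_sym dM b (x n)) (dist_sym dM a y); lra.
pose F A := \bigcup_n linked V t (r n) A n.
have Fsub A : nowhere_dense A -> F A `<=` \bigcup_n closure (V (r n)).
  by move=> nA y [n _ ny]; exists n => //; exact: (linked_sub tP nA) ny.
have Fcl A : nowhere_dense A -> closed (F A).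
  move=> nA; apply: closed_locally_finite => [|n _]; last exact: (linked_closed VT tP).
  by apply: locally_finite_sub rlf => // n _; exact: (linked_sub tP nA).
have FA A : nowhere_dense A -> F A `&` closure A = set0.
  move=> nA; apply/seteqP; split=> // y [[n _ ny] Ay].
  by have := linked_disjoint tP n nA (Vr n); rewrite -subset0 => /(_ y); apply.
pose G : set_system X := fun N => exists2 As : seq (set X),
  (forall A, A \in As -> nowhere_dense A) & [set y | forall A, A \in As -> F A y] `<=` N.
have GF : ProperFilter G.
  split.
    move=> [As nAs AN]; have [y yP] := linked_finite_meet VT tP nAs (Vr (size As)).
    by apply: (AN y) => A AAs; exists (size As) => //; exact: yP.
  split.
  - by exists [::].
  - move=> N M [As nAs AN] [Bs nBs BM]; exists (As ++ Bs).
      by move=> A; rewrite mem_cat => /orP[/nAs|/nBs].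
    move=> y yP; split; [apply: AN|apply: BM] => A AAs; apply: yP;
      by rewrite mem_cat AAs ?orbT.
  - by move=> N M NM [As nAs AN]; exists As => // y /AN/NM.
have [p pG] := stone_cech_cluster R GF.
have pF A : nowhere_dense A -> closure (@sc_embed R X @` F A) p.
  move=> nA; apply/closure_traceP => N pN; apply: pG => //.
  exists [:: A] => [B|y]; first by rewrite inE => /eqP ->.
  by apply; exact: mem_head.
have rp : remote_point p.
  apply/remote_pointE => // A nA pA.
  apply: (@normal_disjoint R X p (F A) (closure A)) => //.
  - exact: metric_normal dM.
  - exact: Fcl.
  - exact: closed_closure.
  - exact: FA.
  - by split; [exact: pF|apply: closure_embS pA; exact: subset_closure].
exists (SigSub (mem_set (rp : [set q | remote_point q] _))) => /= pU.
(* The set assigned to the empty set already lies in [U], which keeps the point off the closure of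
   the complement. *)
have n0 : nowhere_dense (set0 : set X) by rewrite /nowhere_dense closure0 interior0.
apply: (@normal_disjoint R X p (F set0) (~` U)) => //.
- exact: metric_normal dM.
- exact: Fcl.
- exact: open_closedC.
- by apply/seteqP; split=> // y [/(Fsub _ n0)[n _ /(rP n).2[]]].
- by split=> //; exact: pF.
Qed.

(** * Splitting open sets into a prescribed number of pieces *)

Section Separated.
Variables (R : realType) (X : topologicalType) (d : X -> X -> R).
Hypothesis dM : compatible_metric d.

(** Greedy choice: while finitely many balls fail to cover [U], another point at distance at least
    [e] from their centres can be added. *)
Lemma separated_or_totally_bounded (U : set X) e : 0 < e ->
  separated_sequence d U \/
  exists s : seq X, U `<=` [set y | exists2 x, x \in s & dball d x e y].
Proof.
move=> e0; have [h|h] := pselect (exists s : seq X, U `<=` [set y | exists2 x, x \in s & dball d x e y]).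
  by right.
left; have /choice[nxt nP] : forall s : seq X, exists y, U y /\ forall x, x \in s -> e <= d x y.
  move=> s; apply: contrapT => hs; apply: h; exists s => y Uy.
  apply: contrapT => ns; apply: hs; exists y; split=> // x xs.
  by rewrite leNgt; apply/negP => xy; apply: ns; exists x.
pose xs := fix xs n : seq X := if n is m.+1 then nxt (xs m) :: xs m else [::].
exists e => //; exists (fun n => nxt (xs n)); split; first by move=> n; have [] := nP (xs n).
have lt m n : (m < n)%N -> nxt (xs m) \in xs n.
  elim: n => [//|n IH]; rewrite ltnS leq_eqVlt => /orP[/eqP -> /=|/IH mn /=].
    exact: mem_head.
  by rewrite inE mn orbT.
move=> m n /eqP; rewrite neq_ltn => /orP[] /lt hm.
  by have [_] := nP (xs n); exact.
by rewrite (dist_sym dM); have [_] := nP (xs m); exact.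
Qed.

(** Otherwise [U] is totally bounded, every ultrafilter on its closure is Cauchy, and by
    completeness the closure is a compact neighbourhood. *)
Lemma nlc_separated (U : set X) : nowhere_locally_compact X -> complete_metric d ->
  open U -> U !=set0 -> separated_sequence d U.
Proof.
move=> nlc dc oU [x0 Ux0]; apply: contrapT => nsep; apply: (nlc x0); exists (closure U).
  apply: filterS (open_nbhs_nbhs (conj oU Ux0)); exact: subset_closure.
rewrite compact_ultra => F FU FclU.
have PF : ProperFilter F by exact: ultra_proper.
have Fc e : 0 < e -> exists x : X, F [set y | d x y < e].
  move=> e0; have e20 : 0 < e / 2 by rewrite divr_gt0.
  have [//|[s sU]] := separated_or_totally_bounded U e20.
  have Fs : F [set y | exists2 x, x \in s & dball d x e y].
    apply: filterS FclU => y /(_ _ (dball_nbhs dM y e20))[z [/sU[x xs xz] yz]].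
    exists x => //; have := dist_triangle dM z x y; move: xz yz.
    by rewrite /dball /= (dist_sym dM z y); lra.
  elim: s Fs {sU} => [|a s IH] Fs; first by have [y []] := filter_ex Fs.
  have [Fa|Fa] := in_ultra_setVsetC (dball d a e) FU; first by exists a.
  apply: IH; apply: filterS (filterI Fa Fs) => y [nay [x]].
  by rewrite inE => /orP[/eqP -> //|xs xy]; exists x.
have [x Fx] := dc F PF Fc; exists x; split=> // N xN.
have [y [yU Ny]] := filter_ex (filterI FclU (Fx _ (nbhs_interior xN))).
have [z [Uz Nz]] := yU _ (open_nbhs_nbhs (conj (@open_interior _ N) Ny)).
by exists z; split=> //; exact: interior_subset.
Qed.

End Separated.

(** * Cellularity through indexed disjoint families *)

Section DisjointFamily.
Implicit Types (T : topologicalType).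

Definition disjoint_family T (J : Type) (G : J -> set T) : Prop :=
  [/\ forall j, open (G j), forall j, G j !=set0 &
      forall i j, G i `&` G j !=set0 -> i = j].

Lemma cellular_familyP T (L : Type) :
  (forall F : set (set T), cellular_family F -> F #<= [set: L]) <->
  (forall (J : Type) (G : J -> set T), disjoint_family G -> inj_le J L).
Proof.
split=> [h J G [oG G0 Gd]|h F [Fo Ft]].
  have /h/card_le_TP le : cellular_family (range G).
    split; first by move=> _ [j _ <-].
    by move=> _ _ [i _ <-] [j _ <-] /Gd ->.
  apply: inj_le_trans le.
  exists (fun j => SigSub (mem_set (imageT G j))) => i j /(congr1 val) /= e.
  by apply: Gd; have [x Gx] := G0 i; exists x; split=> //; rewrite -e.
apply/card_le_TP; apply: (h (set_type F) val); split.
- by move=> U; have [] := Fo _ (set_valP U).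
- by move=> U; have [] := Fo _ (set_valP U).
- by move=> U W UW; apply: val_inj; apply: Ft; [exact: set_valP|exact: set_valP|].
Qed.

Lemma has_cellularityP T (K : Type) : has_cellularity T K <->
  (forall (J : Type) (G : J -> set T), disjoint_family G -> inj_le J K) /\
  (forall L : Type, (forall (J : Type) (G : J -> set T), disjoint_family G -> inj_le J L) ->
     inj_le K L).
Proof.
split=> -[h1 h2]; split.
- exact/cellular_familyP.
- by move=> L /cellular_familyP/h2/card_le_setTP.
- exact/cellular_familyP.
- by move=> L /cellular_familyP/h2/card_le_setTP.
Qed.

Lemma disjoint_family_val T (U : set T) (J : Type) (G : J -> set (set_type U)) :
  open U -> disjoint_family G -> disjoint_family (fun j => val @` G j : set T).
Proof.
move=> oU [oG G0 Gd]; split.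
- move=> j; rewrite openE => _ [x Gx <-].
  have /nbhs_set_type[C [oC Cx] CG] : nbhs x (G j) by apply: open_nbhs_nbhs; split.
  apply: filterS (open_nbhs_nbhs (conj (openI oC oU) (conj Cx (set_valP x)))).
  move=> y [Cy Uy]; exists (SigSub (mem_set Uy)) => //; exact: CG.
- by move=> j; have [x Gx] := G0 j; exists (val x), x.
- move=> i j [_ [[x Gx <-] [y Gy /val_inj e]]]; apply: Gd; exists x; split=> //.
  by rewrite -e.
Qed.

Lemma disjoint_family_preimage T (U : set T) (J : Type) (G : J -> set T) :
  (forall j, G j `<=` U) -> disjoint_family G ->
  disjoint_family (fun j => val @^-1` G j : set (set_type U)).
Proof.
move=> GU [oG G0 Gd]; split.
- by move=> j; exists (G j).
- by move=> j; have [x Gx] := G0 j; exists (SigSub (mem_set (GU j x Gx))).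
- by move=> i j [x [Gi Gj]]; apply: Gd; exists (val x).
Qed.

End DisjointFamily.

Lemma locally_finite_comp (X : topologicalType) (I J : choiceType) (D : set J)
    (f : J -> I) (V : I -> set X) (W : J -> set X) :
  locally_finite setT V -> (forall j j', D j -> D j' -> f j = f j' -> j = j') ->
  (forall j, D j -> W j `<=` V (f j)) -> locally_finite D W.
Proof.
move=> lf fI WV x; have [G xG fG] := lf x; exists G => //.
set S := [set j | _]; have SI : {in S &, injective f}.
  by move=> i j /set_mem[Di _] /set_mem[Dj _]; exact: fI.
rewrite -(eq_finite_set (inj_card_eq SI)); apply: sub_finite_set fG.
by move=> _ [j [Dj [y [Wy Gy]]] <-]; split=> //; exists y; split=> //; exact: WV.
Qed.

Section Split.
Variables (R : realType) (X : topologicalType) (d : X -> X -> R) (K : choiceType).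
Hypothesis dM : compatible_metric d.
Hypothesis Kinf : inj_le nat K.
Hypothesis upper : forall (J : Type) (G : J -> set X), disjoint_family G -> inj_le J K.
Hypothesis lower : forall (U : set X) (L : Type), open U -> U !=set0 ->
  (forall (J : Type) (G : J -> set X), (forall j, G j `<=` U) -> disjoint_family G -> inj_le J L) ->
  inj_le K L.
Hypothesis sep : forall U : set X, open U -> U !=set0 -> separated_sequence d U.

Lemma separated_family (U : set X) : open U -> U !=set0 -> exists B : nat -> set X,
  [/\ disjoint_family B, forall n, B n `<=` U & locally_finite setT B].
Proof.
move=> oU /(sep oU)[e e0 [x [xU xe]]].
have e40 : 0 < e / 4 by rewrite divr_gt0.
exists (fun n => U `&` dball d (x n) (e / 4)); split; first split.
- by move=> n; apply: openI => //; exact: dball_open.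
- by move=> n; exists (x n); split=> //; exact: dball_center.
- move=> m n [y [[_ my] [_ ny]]]; apply: contrapT => /xe.
  by have := dist_triangle dM y (x m) (x n); move: my ny; rewrite /dball /= (dist_sym dM (x n)); lra.
- by move=> n y [].
- move=> y; exists (dball d y (e / 4)); first exact: dball_nbhs.
  apply: finite_subsingleton => m n [_ [a [[_ ma] ya]]] [_ [b [[_ nb] yb]]].
  apply: contrapT => /xe.
  have := dist_triangle dM a (x m) (x n); have := dist_triangle dM y a (x n).
  have := dist_triangle dM b y (x n).
  move: ma nb ya yb; rewrite /dball /= (dist_sym dM b (x n)) (dist_sym dM a y); lra.
Qed.

Section Cells.
Variables (I : choiceType) (W : nat -> I -> set X).
Hypothesis W_open : forall n i, open (W n i).
Hypothesis W_disj : forall n i j, W n i `&` W n j !=set0 -> i = j.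
Hypothesis W_lf : forall n, locally_finite setT (W n).
Hypothesis W_dense : forall n G, open G -> G !=set0 -> exists i, G `&` W n i !=set0.
Hypothesis W_small : forall n i x y, W n i x -> W n i y -> d x y < mesh R n.

Let cells (G : set X) n := set_type [set i | W n i `&` G !=set0].

(** The cells of all levels are fine enough that each member of a disjoint family in [U] contains
    one. Their number therefore bounds all such families, and [K] is at most any such bound. *)
Lemma cells_lower (U : set X) : open U -> U !=set0 ->
  inj_le K (set_type [set p : nat * I | W p.1 p.2 `&` U !=set0]).
Proof.
move=> oU U0; apply: (lower oU U0) => J G GU [oG G0 Gd].
have /choice[p pP] : forall j, exists p : nat * I,
    W p.1 p.2 !=set0 /\ W p.1 p.2 `<=` G j.
  move=> j; have [x Gx] := G0 j; have [e e0 eG] := open_dball dM (oG j) Gx.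
  have e20 : 0 < e / 2 by rewrite divr_gt0.
  have [n ne] := mesh_small e20.
  have [|i [y [xy Wy]]] := @W_dense n _ (dball_open dM x (e / 2)).
    by exists x; exact: dball_center.
  exists (n, i); split; first by exists y.
  move=> z Wz; apply: eG; have := W_small Wy Wz; have := dist_triangle dM y x z.
  by move: xy; rewrite /dball /=; lra.
have pU j : W (p j).1 (p j).2 `&` U !=set0.
  by have [[x Wx] WG] := pP j; exists x; split=> //; apply/(GU j)/WG.
exists (fun j => SigSub (mem_set (pU j : [set p : nat * I | W p.1 p.2 `&` U !=set0] (p j)))).
move=> i j /(congr1 val) /= e; apply: Gd; have [[x Wx] WG] := pP i.
by exists x; split; [exact: WG|apply: (pP j).2; rewrite -e].
Qed.

(** If every level of [U] had at most as many cells as level [n] of [U'], then [K] would be at most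
    countably many times that number, hence countable or again bounded by that number. *)
Lemma cells_large (U U' : set X) n : open U -> U !=set0 ->
  ~ inj_le K nat -> ~ inj_le K (cells U' n) ->
  exists m, inj_le (cells U' n) (cells U m).
Proof.
move=> oU U0 Kunc Kn; apply: contrapT => hm.
have le m : inj_le (cells U m) (cells U' n).
  have [|//] := inj_le_total (cells U' n) (cells U m).
  by move=> h; case: hm; exists m.
have Kle : inj_le K (nat * cells U' n)%type.
  apply: inj_le_trans (cells_lower oU U0) _.
  pose f m := projT1 (cid (le m)).
  have fP m : injective (f m) := projT2 (cid (le m)).
  exists (fun q => ((val q).1, f (val q).1
     (SigSub (mem_set (set_valP q : [set i | W (val q).1 i `&` U !=set0] (val q).2))))).
  move=> [[m i] qP] [[m' i'] q'P] /= [mm]; subst m' => /fP[e]; subst i'.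
  exact: val_inj.
have [inf|fin] := inj_le_total nat (cells U' n).
  by apply: Kn; apply: inj_le_trans Kle (infinite_nat_prod inf).
apply: Kunc; apply: inj_le_trans Kle (inj_le_trans _ nat_pair_inj).
have [f fI] := fin; exists (fun p => (p.1, f p.2)) => -[a b] [a' b'] /= [-> /fI ->] //.
Qed.

Lemma large_family (U : set X) : open U -> U !=set0 -> exists G : K -> set X,
  [/\ disjoint_family G, forall k, G k `<=` U & locally_finite setT G].
Proof.
move=> oU U0; have [B [[oB B0 Bd] BU Blf]] := separated_family oU U0.
have [[f fI]|Kunc] := pselect (inj_le K nat).
  exists (fun k => B (f k)); split; first split=> //.
  - by move=> i j /Bd/fI.
  - by move=> k; exact: BU.
  - by apply: (@locally_finite_comp _ _ _ _ f _ _ Blf) => [j j' _ _ /fI //|j _ y].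
have [[n [f fI]]|Kn] := pselect (exists n, inj_le K (cells (B 0%N) n)).
  exists (fun k => W n (val (f k)) `&` B 0%N); split; first split=> //.
  - by move=> k; exact: openI.
  - by move=> k; exact: set_valP (f k).
  - by move=> i j [x [[Wi _] [Wj _]]]; apply/fI/val_inj/(@W_disj n); exists x.
  - by move=> k x [_ /BU].
  - apply: (@locally_finite_comp _ _ _ _ (fun k => val (f k)) _ _ (W_lf n)).
      by move=> j j' _ _ /val_inj/fI.
    by move=> j _ x [].
(* No level over [B 0] has [K] cells, but all levels together do. Level [n] is copied into cells
   meeting [B n.+1], so that distinct levels land in disjoint open sets of a locally finite
   sequence. *)
have /choice[m mP] : forall n, exists m, inj_le (cells (B 0%N) n) (cells (B n.+1) m).
  by move=> n; apply: cells_large => // h; apply: Kn; exists n.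
pose g n := projT1 (cid (mP n)).
have gP n : injective (g n) := projT2 (cid (mP n)).
have [f fI] := cells_lower (oB 0%N) (B0 0%N).
pose lev k := (val (f k)).1.
pose idx k : cells (B 0%N) (lev k) := SigSub (mem_set
  (set_valP (f k) : [set i | W (lev k) i `&` B 0%N !=set0] (val (f k)).2)).
pose G k := W (m (lev k)) (val (g (lev k) (idx k))) `&` B (lev k).+1.
have same k k' : lev k = lev k' ->
    val (g (lev k) (idx k)) = val (g (lev k') (idx k')) -> k = k'.
  move=> e; rewrite /idx; move: (set_valP (f k)) (set_valP (f k')).
  rewrite /lev in e *.
  case: (f k) (fI k k') e => -[a i] /= h; case: (f k') => -[a' i'] /= h' fkk e; subst a'.
  move=> w w' /val_inj/gP[e]; subst i'; apply: fkk; exact: val_inj.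
exists G; split; first split.
- by move=> k; apply: openI.
- by move=> k; exact: set_valP (g (lev k) (idx k)).
- move=> k k' [x [[Wx Bx] [W'x B'x]]].
  have e : lev k = lev k' by apply: succn_inj; apply: Bd; exists x.
  apply: same => //; apply: (@W_disj (m (lev k))); exists x; split=> //.
  by rewrite {1}e.
- by move=> k x [_ /BU].
apply: (@locally_finite_sub _ _ (\bigcup_n [set k | lev k = n]) _ G G) => [k _|k _ x //|].
  by exists (lev k).
apply: (@locally_finite_bind _ _ _ setT (fun n => B n.+1)).
- by apply: (@locally_finite_comp _ _ _ _ S _ _ Blf) => [i j _ _ []|j _ y].
- move=> n _; apply: (@locally_finite_comp _ _ _ _ (fun k => val (g (lev k) (idx k))) _ _ (W_lf (m n))).
    by move=> k k' /= kn k'n; apply: same; rewrite kn.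
  by move=> k /= <- x [].
- by move=> n k _ /= <- x [].
Qed.

End Cells.

(** A large family, cut down to small balls, already has [K] members; Stone cells outside its
    closure [Q] fill the rest of [U]. By [upper] there are at most [K] of these, so the total is
    exactly [K]. *)
Lemma split_family (U : set X) (e : R) : open U -> U !=set0 -> 0 < e ->
  exists V : K -> set X, [/\ disjoint_family V, forall k, V k `<=` U,
    locally_finite setT V, (forall G, open G -> G `&` U !=set0 -> exists k, G `&` V k !=set0) &
    forall k x y, V k x -> V k y -> d x y < e].
Proof.
move=> oU U0 e0.
pose Wn n := projT1 (cid (stone_cells dM (mesh_gt0 R n))).
have WnP n := projT2 (cid (stone_cells dM (mesh_gt0 R n))).
have W1 n i : open (Wn n i) by have [h _ _ _ _] := WnP n; exact: h.
have W2 n i j : Wn n i `&` Wn n j !=set0 -> i = j.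
  by have [_ h _ _ _] := WnP n; exact: h.
have W3 n : locally_finite setT (Wn n) by have [_ _ h _ _] := WnP n.
have W4 n H : open H -> H !=set0 -> exists i, H `&` Wn n i !=set0.
  by have [_ _ _ h _] := WnP n; exact: h.
have W5 n i x y : Wn n i x -> Wn n i y -> d x y < mesh R n.
  by have [_ _ _ _ h] := WnP n; exact: h.
have [G [[oG G0 Gd] GU Glf]] := large_family W1 W2 W3 W4 W5 oU U0.
have /choice[g gP] := G0.
have e20 : 0 < e / 2 by rewrite divr_gt0.
pose B k := G k `&` dball d (g k) (e / 2).
pose Q := closure (\bigcup_k B k).
have [W [oW Wd Wlf Wdn Ws]] := stone_cells dM e0.
pose C i := W i `&` U `&` ~` Q.
have oC i : open (C i).
  apply: openI; first by apply: openI.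
  by apply: closed_openC; exact: closed_closure.
pose J := set_type [set i | C i !=set0].
have JK : inj_le J K.
  apply: (upper (G := fun j : J => C (val j))); split=> //.
    by move=> j; exact: set_valP j.
  by move=> i j [x [[[Wi _] _] [[Wj _] _]]]; apply/val_inj/Wd; exists x.
have [f [f' fK f'K]] := infinite_sum_bij Kinf JK.
pose V' (s : K + J) := match s with inl k => B k | inr j => C (val j) end.
have BQ k : B k `<=` Q by move=> x Bx; apply: subset_closure; exists k.
have V'd s s' : V' s `&` V' s' !=set0 -> s = s'.
  case: s s' => [k|j] [k'|j'] [x] /=.
  - by move=> [[Gk _] [Gk' _]]; rewrite (Gd k k')//; exists x.
  - by move=> [/BQ Qx [_ nQx]].
  - by move=> [[_ nQx] /BQ Qx].
  - by move=> [[[Wi _] _] [[Wj _] _]]; congr inr; apply/val_inj/Wd; exists x.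
have V'lf : locally_finite setT V'.
  have Wlf' : locally_finite setT (fun j : J => W (val j)).
    by apply: (@locally_finite_comp _ _ _ _ val _ _ Wlf) => [i j _ _ /val_inj//|j _ y].
  move=> x; have [G1 xG1 fG1] := Glf x; have [G2 xG2 fG2] := Wlf' x.
  exists (G1 `&` G2); first exact: filterI.
  apply: (@sub_finite_set _ _ ((inl @` [set k | [set: K] k /\ G k `&` G1 !=set0]) `|`
     (inr @` [set j : J | [set: J] j /\ W (val j) `&` G2 !=set0]))).
    move=> [k|j] [_ [y [Vy [G1y G2y]]]].
      by left; exists k => //; split=> //; exists y; split=> //; case: Vy.
    by right; exists j => //; split=> //; exists y; split=> //; case: Vy => -[].
  by rewrite finite_setU; split; exact: finite_image.
exists (fun k => V' (f k)); split; first split.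
- move=> k; case: (f k) => [k'|j] /=; last exact: oC.
  by apply: openI => //; exact: dball_open.
- move=> k; case: (f k) => [k'|j] /=; last exact: set_valP j.
  by exists (g k'); split; [exact: gP|exact: dball_center].
- by move=> i j /V'd/(can_inj fK).
- by move=> k x; case: (f k) => [k'|j] /=; [move=> [/GU]|move=> [[]]].
- by apply: (@locally_finite_comp _ _ _ _ f _ _ V'lf) => [i j _ _ /(can_inj fK)//|j _ y].
- move=> H oH [x [Hx Ux]].
  suff [s Hs] : exists s, H `&` V' s !=set0 by exists (f' s); rewrite f'K.
  (* Either [H]&[U] leaves [Q] and meets a filling cell, or it lies in the closure of the balls and
     meets one of them. *)
  have [[y [[Hy Uy] nQy]]|HQ] := pselect (H `&` U `&` ~` Q !=set0).
    have [||i [z [[[Hz Uz] nQz] Wz]]] := Wdn (H `&` U `&` ~` Q).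
    - apply: openI; first exact: openI.
      by apply: closed_openC; exact: closed_closure.
    - by exists y.
    have Ci : C i !=set0 by exists z.
    by exists (inr (SigSub (mem_set (Ci : [set i | C i !=set0] i)))), z.
  have Qx : Q x by apply: contrapT => nQx; apply: HQ; exists x.
  have [y [[k _ By] [Hy _]]] := Qx _ (open_nbhs_nbhs (conj (openI oH oU) (conj Hx Ux))).
  by exists (inl k), y.
- move=> k x y; case: (f k) => [k'|j] /=; last by move=> [[Wx _] _] [[Wy _] _]; exact: Ws Wy.
  move=> [_ xk] [_ yk]; have := dist_triangle dM (g k') x y.
  by move: xk yk; rewrite /dball /= (dist_sym dM x (g k')); lra.
Qed.

Lemma exists_full_tree : [set: X] !=set0 -> exists2 V : seq K -> set X,
  open_tree d V & forall s, V s !=set0.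
Proof.
move=> X0.
have /choice[sp spP] : forall Un : set X * nat, exists V : K -> set X,
    open Un.1 -> Un.1 !=set0 -> [/\ disjoint_family V, forall k, V k `<=` Un.1,
    locally_finite setT V,
    (forall G, open G -> G `&` Un.1 !=set0 -> exists k, G `&` V k !=set0) &
    forall k x y, V k x -> V k y -> d x y < mesh R Un.2].
  move=> [U n] /=.
  have [[oU U0]|nU] := pselect (open U /\ U !=set0).
    by have [V VP] := split_family oU U0 (mesh_gt0 R n); exists V.
  by exists (fun=> set0) => oU U0; case: nU.
pose V := fix V (s : seq K) : set X :=
  if s is k :: s' then sp (V s', size s') k else setT.
have V0 s : open (V s) /\ V s !=set0.
  elim: s => [|k s [oV V0]] /=; first by split=> //; exact: openT.
  by have [[oW W0 _] _ _ _ _] := spP (V s, size s) oV V0; split.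
have VP s := spP (V s, size s) (V0 s).1 (V0 s).2.
exists V => [|s]; last exact: (V0 s).2.
split=> //.
- by move=> s; exact: (V0 s).1.
- by move=> k s; have [_ h _ _ _] := VP s; exact: h.
- by move=> s i j; have [[_ _ h] _ _ _ _] := VP s; exact: h.
- by move=> s; have [_ _ h _ _] := VP s.
- by move=> s G; have [_ _ _ h _] := VP s; exact: h.
- by move=> k s x y; have [_ _ _ _ h] := VP s; exact: h.
Qed.

End Split.

(** * The space of branches *)

Section Baire.
Variable K : choiceType.
Local Notation Y := (baire_space K).
Implicit Types (b : Y) (n : nat).

Definition cone b n : set Y := [set b' : Y | forall i, (i < n)%N -> b' i = b i :> K].

Lemma nbhs_cone b n : nbhs b (cone b n).
Proof.
elim: n => [|n IH]; first by apply: filterS filterT.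
have h : nbhs b [set b' : Y | b' n = b n :> K].
  have := @proj_continuous _ (fun _ : nat => discrete_topology K : topologicalType) n b.
  by move=> /(_ _ (discrete_set1 (b n : discrete_topology K))).
apply: filterS (filterI h IH) => b' [b'n b'P] i; rewrite ltnS leq_eqVlt.
by move=> /orP[/eqP ->|/b'P].
Qed.

Lemma nbhs_baireP b (A : set Y) : nbhs b A <-> exists n, cone b n `<=` A.
Proof.
split=> [/nbhs_power[s [N bN NA]]|[n nA]]; last by apply: filterS (nbhs_cone b n).
exists (\max_(i <- s) i).+1 => b' b'P; apply: NA => i si.
have -> : b' i = b i by apply: b'P; rewrite ltnS; exact: leq_bigmax_seq.
exact: nbhs_singleton.
Qed.

Lemma cone_open b n : open (cone b n).
Proof.
rewrite openE => b' b'P; apply/nbhs_baireP; exists n => c cP i ni.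
by rewrite cP// b'P.
Qed.

(** Reversed to match the nodes, whose last choice comes first. *)
Definition branch b n : seq K := rev (mkseq b n).

Lemma branchS b n : branch b n.+1 = b n :: branch b n.
Proof. by rewrite /branch mkseqS rev_rcons. Qed.

Lemma size_branch b n : size (branch b n) = n.
Proof. by rewrite size_rev size_mkseq. Qed.

Lemma coneP b b' n : cone b n b' <-> branch b' n = branch b n.
Proof.
split=> [h|/(can_inj revK) h i ni].
  congr rev; apply/eq_in_map => i; rewrite mem_iota add0n => /andP[_]; exact: h.
by rewrite -(nth_mkseq (b i) b ni) -(nth_mkseq (b i) b' ni) h.
Qed.

Variable k0 : K.

(** Some branch through the node [s]; [k0] fills the coordinates beyond it. *)
Definition through (s : seq K) : Y := fun i => nth k0 (rev s) i.

Lemma branch_through s : branch (through s) (size s) = s.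
Proof. by rewrite /branch /through -(size_rev s) mkseq_nth revK. Qed.

End Baire.

Section TreeMap.
Variables (R : realType) (X : topologicalType) (d : X -> X -> R) (K : choiceType).
Hypothesis dM : compatible_metric d.
Hypothesis dc : complete_metric d.
Variable V : seq K -> set X.
Hypothesis VT : open_tree d V.
Hypothesis V0 : forall s, V s !=set0.
Variable k0 : K.
Local Notation Y := (baire_space K).

Lemma branch_sub (b : Y) m n : (m <= n)%N -> V (branch b n) `<=` V (branch b m).
Proof.
move=> /subnK <-; elim: (n - m)%N => [//|k IH].
rewrite addSn branchS; apply: subset_trans IH; exact: (tree_sub VT).
Qed.

Lemma exists_tree_point (b : Y) : exists x, forall n, closure (V (branch b n)) x.
Proof.
pose F : set_system X := fun N => exists n, V (branch b n) `<=` N.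
have FF : ProperFilter F.
  split; first by move=> [n h]; have [x /h] := V0 (branch b n).
  split; first by exists 0%N.
  - move=> N M [n nN] [m mM]; exists (maxn n m) => x Vx; split.
      by apply/nN/(branch_sub (leq_maxl n m)).
    by apply/mM/(branch_sub (leq_maxr n m)).
  - by move=> N M NM [n nN]; exists n; exact: subset_trans NM.
have [|x Fx] := dc FF.
  move=> e e0; have [n ne] := mesh_small e0.
  have [y Vy] := V0 (branch b n.+1); exists y, n.+1 => z Vz /=.
  move: Vy Vz; rewrite branchS => Vy Vz; apply: lt_trans ne.
  by have := tree_small VT Vy Vz; rewrite size_branch.
exists x => n N /Fx [m mN]; have [y Vy] := V0 (branch b (maxn n m)).
exists y; split; first exact: (branch_sub (leq_maxl n m)).
by apply/mN/(branch_sub (leq_maxr n m)).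
Qed.

Definition tree_map (b : Y) : X := projT1 (cid (exists_tree_point b)).

Lemma tree_mapP (b : Y) n : closure (V (branch b n)) (tree_map b).
Proof. by rewrite /tree_map; case: cid => x /= h; exact: h. Qed.

Lemma closure_tree_small k s x y : closure (V (k :: s)) x -> closure (V (k :: s)) y ->
  d x y <= 2 * mesh R (size s).
Proof.
move=> Vx Vy; have [z Vz] := V0 (k :: s).
have Vb : V (k :: s) `<=` dball d z (mesh R (size s)).
  by move=> w Vw; exact: (tree_small VT Vz Vw).
have := dist_closure_ball dM (closureS Vb Vx).
have := dist_closure_ball dM (closureS Vb Vy).
by have := dist_triangle dM z x y; rewrite (dist_sym dM x z); lra.
Qed.

Lemma tree_map_eq (b : Y) x : (forall n, closure (V (branch b n)) x) -> tree_map b = x.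
Proof.
move=> h; apply: (dist_eq0 dM); apply/eqP; rewrite eq_le (dist_ge0 dM) andbT.
apply/ler_addgt0Pl => e e0; rewrite addr0.
have [|n ne] := mesh_small (e := e / 2); first by rewrite divr_gt0.
have := @tree_mapP b n.+1; have := h n.+1; rewrite branchS => hx hb.
have := closure_tree_small hb hx; rewrite size_branch; lra.
Qed.

Lemma tree_map_continuous : continuous tree_map.
Proof.
move=> b A /(dist_nbhs dM)[e e0 eA].
have [|n ne] := mesh_small (e := e / 2); first by rewrite divr_gt0.
apply/nbhs_baireP; exists n.+1 => b' /coneP bb'; apply: eA => /=.
have := @tree_mapP b n.+1; have := @tree_mapP b' n.+1; rewrite bb' branchS => h' h.
have := closure_tree_small h h'; rewrite size_branch; lra.
Qed.

(** [Cs s] is the image of the part of [C] through [s]. By local finiteness, a point in the closure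
    of [Cs s] is in the closure of [Cs] for some child. Following such children gives a branch,
    which is in [C] because [C] is closed and is mapped to [x] because the nodes shrink. *)
Lemma tree_map_closed (C : set Y) : closed C -> closed (tree_map @` C).
Proof.
move=> clC x xC.
pose Cs s := tree_map @` [set b | C b /\ branch b (size s) = s].
have /choice[nx nxP] : forall s, exists k,
    closure (Cs s) x -> closure (Cs (k :: s)) x.
  move=> s; have [Csx|nCsx] := pselect (closure (Cs s) x); last by exists k0.
  have lf : locally_finite setT (fun k => Cs (k :: s)).
    apply: locally_finite_sub (locally_finite_closure (tree_lf VT s)) => // k _.
    by move=> _ [b [_ bk] <-]; rewrite -bk; exact: tree_mapP.
  suff /(closure_locally_finite lf)[k _ h] : closure (\bigcup_k Cs (k :: s)) x by exists k.
  apply: closureS Csx => _ [b [Cb bs] <-]; exists (b (size s)) => //.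
  by exists b => //; split=> //=; rewrite branchS bs.
pose bs := fix bs n := if n is m.+1 then nx (bs m) :: bs m else [::].
have szbs n : size (bs n) = n by elim: n => //= n ->.
pose b : Y := fun n => nx (bs n).
have bbs n : branch b n = bs n by elim: n => // n IH; rewrite branchS IH.
have good n : closure (Cs (branch b n)) x.
  elim: n => [|n IH]; last by rewrite branchS bbs; apply: nxP; rewrite -bbs.
  apply: closureS xC => _ [c Cc <-]; exists c => //; split=> //.
exists b.
  apply: clC => N /nbhs_baireP[n nN]; have [|_ [[c [Cc cb] _] _]] := good n setT.
    exact: filterT.
  by exists c; split=> //; apply: nN; apply/coneP; rewrite -{1}(size_branch b n).
apply: tree_map_eq => n; apply: closed_subset_closure (good n); first exact: closed_closure.
by move=> _ [c [_ <-] <-]; exact: tree_mapP.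
Qed.

Lemma tree_map_surj x : exists b, tree_map b = x.
Proof.
have clT : closed (tree_map @` setT) by apply: tree_map_closed; exact: closedT.
suff /clT[b _ bx] : closure (tree_map @` setT) x by exists b.
move=> N; rewrite nbhsE => -[G [oG Gx] GN].
have [|s [_ _ sG]] := tree_shrink dM VT 0 oG; first by exists x.
exists (tree_map (through k0 s)); split; first by exists (through k0 s).
apply/GN/sG; have := @tree_mapP (through k0 s) (size s).
by rewrite branch_through.
Qed.

(** Any point of an open node will do: another node of the same length is disjoint from it, and so
    is the closure of that node. *)
Lemma tree_map_irreducible (W : set Y) : open W -> W !=set0 ->
  exists x, forall b, tree_map b = x -> W b.
Proof.
move=> oW [b Wb]; have /nbhs_baireP[n nW] := open_nbhs_nbhs (conj oW Wb).
have [x Vx] := V0 (branch b n); exists x => b' b'x; apply: nW; apply/coneP.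
have := @tree_mapP b' n; rewrite b'x => h.
have [y [Vb' Vb]] := h _ (open_nbhs_nbhs (conj (tree_open VT _) Vx)).
have meet : V (branch b' n) `&` V (branch b n) !=set0 by exists y.
by apply: (tree_meet VT meet _).2; rewrite !size_branch.
Qed.

End TreeMap.

(** * The first-difference ultrametric on the space of branches *)

Section BaireMetric.
Variables (R : realType) (K : choiceType).
Local Notation Y := (baire_space K).

Lemma differ_ex (b c : Y) : b <> c -> exists n, b n != c n.
Proof.
move=> bc; apply: contrapT => h; apply: bc; apply/funext => n.
by apply: contrapT => /eqP bcn; apply: h; exists n.
Qed.

Definition baire_dist (b c : Y) : R :=
  if pselect (b = c) is right bc then mesh R (ex_minn (differ_ex bc)) else 0.

Lemma baire_dist_lt (b c : Y) n : baire_dist b c < mesh R n <-> cone b n.+1 c.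
Proof.
rewrite /baire_dist; case: pselect => [->|bc].
  by split=> // _; exact: mesh_gt0.
case: ex_minnP => m bcm mmin; split=> [mn i ilt|h].
  apply/esym/eqP; apply: contraTT mn => /mmin mi; rewrite -leNgt.
  by apply: mesh_le; apply: leq_trans mi _.
rewrite /mesh ltf_pV2 ?posrE ?ltr0n// ltr_nat ltnS ltnNge -ltnS.
by apply/negP => /h cb; move: bcm; rewrite cb eqxx.
Qed.

Lemma baire_distxx (b : Y) : baire_dist b b = 0.
Proof. by rewrite /baire_dist; case: pselect. Qed.

Lemma baire_dist_ge0 (b c : Y) : 0 <= baire_dist b c.
Proof.
by rewrite /baire_dist; case: pselect => // bc; apply/ltW/mesh_gt0.
Qed.

Lemma baire_dist_sym (b c : Y) : baire_dist b c = baire_dist c b.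
Proof.
have [->//|bc] := pselect (b = c); rewrite /baire_dist.
case: pselect => // bc'; case: pselect => [/esym//|cb].
congr mesh; apply/eqP; rewrite eqn_leq; case: ex_minnP => m bcm mmin.
by case: ex_minnP => n cbn nmin; rewrite mmin 1?eq_sym// nmin 1?eq_sym.
Qed.

Lemma baire_dist_max (b c e : Y) :
  baire_dist b e <= Num.max (baire_dist b c) (baire_dist c e).
Proof.
rewrite leNgt; apply/negP; rewrite gt_max => /andP[].
rewrite {2 4}/baire_dist; case: pselect => [_|be]; first by rewrite ltNge baire_dist_ge0.
case: ex_minnP => m bem _ /baire_dist_lt h1 /baire_dist_lt h2.
by move: bem; rewrite h2// h1// eqxx.
Qed.

Lemma baire_metric : compatible_metric baire_dist.
Proof.
split.
- exact: baire_dist_ge0.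
- exact: baire_distxx.
- move=> b c; rewrite /baire_dist; case: pselect => // bc /eqP.
  by rewrite gt_eqF// mesh_gt0.
- exact: baire_dist_sym.
- move=> c b e; apply: le_trans (baire_dist_max b c e) _.
  by rewrite ge_max lerDl lerDr !baire_dist_ge0.
- move=> b A; rewrite nbhs_baireP; split=> [[n nA]|[e e0 eA]].
    exists (mesh R n); first exact: mesh_gt0.
    move=> c /baire_dist_lt h; apply: nA => i ni; apply: h; exact: leqW.
  have [n ne] := mesh_small e0; exists n.+1 => c /baire_dist_lt bc.
  by apply: eA; exact: lt_trans ne.
Qed.

Hypothesis Kinf : inj_le nat K.

Lemma baire_separated (U : set Y) : open U -> U !=set0 -> separated_sequence baire_dist U.
Proof.
move=> oU [b Ub]; have [f fI] := Kinf.
have /nbhs_baireP[n nU] := open_nbhs_nbhs (conj oU Ub).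
exists (mesh R n); first exact: mesh_gt0.
(* These points share the first [n] coordinates of [b] and first differ from each other at
   coordinate [n]. *)
pose x (k : nat) : Y := fun i => if (i < n)%N then b i else f k.
exists x; split=> [k|k l kl]; first by apply: nU => i ni; rewrite /x ni.
rewrite leNgt; apply/negP => /baire_dist_lt /(_ n (ltnSn n)).
by rewrite /x ltnn => /fI /esym.
Qed.

Lemma baire_point_nwd (b : Y) : nowhere_dense [set b].
Proof.
apply: nowhere_dense_closed; first exact: (metric_closed1 baire_metric).
move=> W oW W0 Wb; have [e e0 [x [xW xe]]] := baire_separated oW W0.
have n01 : 0%N <> 1%N by [].
have := xe _ _ n01; rewrite (Wb _ (xW 0%N)) (Wb _ (xW 1%N)) baire_distxx.
by rewrite leNgt e0.
Qed.

End BaireMetric.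

(** * The main theorem *)

Lemma homeomorphic_sym (X Y : topologicalType) : homeomorphic X Y -> homeomorphic Y X.
Proof. by move=> [f [g [fc gc fK gK]]]; exists g, f. Qed.

(** * Open sets of remote points and transfer of disjoint families *)

Section RemoteOpen.
Variables (R : realType) (X : topologicalType).
Local Notation emb := (@sc_embed R X).
Implicit Types (U W : set X) (p : remote R X).

(** For open [U], the remote points in the largest open subset of the compactification whose trace
    on [X] is [U]. *)
Definition remote_open U : set (remote R X) :=
  [set p | ~ closure (emb @` (~` U)) (val p)].

Lemma remote_open_trace U p : remote_open U p -> exists2 N, trace (val p) N & N `<=` U.
Proof.
move=> /trace_disjoint[N _ [pN UN]]; exists N => // x Nx.
by apply: contrapT => nUx; have : (~` U `&` N) x by []; rewrite UN.
Qed.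

Lemma remote_open_meet U W : remote_open U `&` remote_open W !=set0 -> U `&` W !=set0.
Proof.
move=> [p [/remote_open_trace[N pN NU] /remote_open_trace[M pM MW]]].
have pF := trace_proper (val p).
by have [x [/NU Ux /MW Wx]] := filter_ex (filterI pN pM); exists x.
Qed.

Lemma remote_openS U W : U `<=` W -> remote_open U `<=` remote_open W.
Proof.
by move=> UW p pU pW; apply: pU; apply: closure_embS pW; exact: subsetC.
Qed.

Lemma remote_open_open U : open (remote_open U).
Proof.
rewrite openE => p pU; apply/nbhs_set_type; exists (~` closure (emb @` (~` U))) => //.
by split=> //; apply: closed_openC; exact: closed_closure.
Qed.

Lemma remote_open_base (O : set (remote R X)) : open O -> O !=set0 ->
  exists U, [/\ open U, U !=set0 & remote_open U `<=` O].
Proof.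
move=> oO [p Op]; have /nbhs_remoteP[A [clA Ap AO]] := open_nbhs_nbhs (conj oO Op).
exists (~` A); split.
- exact: closed_openC.
- suff [x [Ax _]] : ~` A `&` ~` A !=set0 by exists x.
  by apply: remote_open_meet; exists p; rewrite /remote_open /= setCK.
- by move=> q; rewrite /remote_open /= setCK; exact: AO.
Qed.

Definition remote_rich : Prop :=
  forall U, open U -> U !=set0 -> remote_open U !=set0.

End RemoteOpen.

Lemma metric_remote_rich (R : realType) (X : topologicalType) (d : X -> X -> R) :
  compatible_metric d -> (forall x : X, nowhere_dense [set x]) ->
  (forall U : set X, open U -> U !=set0 -> separated_sequence d U) ->
  remote_rich R X.
Proof.
move=> dM nwd1 sep U oU U0.
by have [p pU] := exists_remote dM nwd1 oU (sep U oU U0); exists p.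
Qed.

(** Each [G j] traps a remote point, so its set of remote points pulls back along [g] to a non-empty
    open set, inside which a basic one is chosen. If two of the chosen sets met, a remote point
    trapped in the overlap would be sent by [g] into both originals. *)
Lemma transfer_family (R : realType) (X Y : topologicalType)
    (f : remote R X -> remote R Y) (g : remote R Y -> remote R X)
    (J : Type) (G : J -> set X) :
  continuous g -> cancel f g -> remote_rich R X -> remote_rich R Y ->
  disjoint_family G -> exists2 W : J -> set Y, disjoint_family W &
    forall j, remote_open (R := R) (W j) `<=` g @^-1` remote_open (G j).
Proof.
move=> gc fK rX rY [oG G0 Gd].
have /choice[W WP] : forall j, exists W : set Y, [/\ open W, W !=set0 &
    remote_open (R := R) W `<=` g @^-1` remote_open (G j)].
  move=> j; apply: remote_open_base.
    by apply: open_comp; [move=> q _; exact: gc|exact: remote_open_open].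
  by have [p Gp] := rX _ (oG j) (G0 j); exists (f p); rewrite /= fK.
exists W => [|j]; last by have [] := WP j.
split=> [j|j|i j Wij]; [by have [] := WP j|by have [] := WP j|].
have [oi _ hi] := WP i; have [oj _ hj] := WP j.
have [q qW] := rY _ (openI oi oj) Wij.
apply: Gd; apply: (@remote_open_meet R); exists (g q); split.
  by apply: hi; apply: remote_openS qW => y [].
by apply: hj; apply: remote_openS qW => y [].
Qed.

Section BaireFamilies.
Variable K : choiceType.
Hypothesis Kinf : inj_le nat K.
Local Notation Y := (baire_space K).

(** The eventually constant branches [through] a node are dense and indexed by [seq K], which is no
    larger than [K]. *)
Lemma baire_family_le (J : Type) (G : J -> set Y) : disjoint_family G -> inj_le J K.
Proof.
move=> [oG G0 Gd]; apply: inj_le_trans (infinite_seq_inj Kinf).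
have [nu _] := Kinf.
have /choice[s sP] : forall j, exists s : seq K, G j (through (nu 0%N) s).
  move=> j; have [b Gb] := G0 j.
  have /nbhs_baireP[n nG] := open_nbhs_nbhs (conj (oG j) Gb).
  exists (branch b n); apply/nG/coneP.
  by have := branch_through (nu 0%N) (branch b n); rewrite size_branch.
exists s => i j e; apply: Gd; exists (through (nu 0%N) (s i)); split=> //.
by rewrite e.
Qed.

Lemma baire_family_ge (U : set Y) : open U -> U !=set0 ->
  exists2 G : K -> set Y, disjoint_family G & forall k, G k `<=` U.
Proof.
move=> oU [b Ub]; have /nbhs_baireP[n nU] := open_nbhs_nbhs (conj oU Ub).
pose x k : Y := fun i => if (i < n)%N then b i else k.
exists (fun k => cone (x k) n.+1); first split.
- by move=> k; exact: cone_open.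
- by move=> k; exists (x k).
- move=> k l [c [ck cl]]; have := ck n (ltnSn n); rewrite cl// /x ltnn.
  by move/esym.
- move=> k c ck; apply: nU => i ni; rewrite ck; last exact: leqW.
  by rewrite /x ni.
Qed.

End BaireFamilies.

Section Main.
Variables (R : realType) (X : topologicalType) (K : choiceType).
Variable d : X -> X -> R.
Hypothesis dM : compatible_metric d.
Hypothesis dc : complete_metric d.
Hypothesis nlc : nowhere_locally_compact X.
Hypothesis Kinf : inj_le nat K.
Local Notation Y := (baire_space K).

Let X_rich : remote_rich R X.
Proof.
apply: (metric_remote_rich dM) => [x|U oU U0]; first exact: (nlc_point_nwd dM).
exact: nlc_separated.
Qed.

Let Y_rich : remote_rich R Y.
Proof.
apply: (metric_remote_rich (baire_metric R K)) => [b|U oU U0].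
  exact: baire_point_nwd.
exact: baire_separated.
Qed.

Lemma homeomorphic_uniform_cellularity :
  homeomorphic (remote R X) (remote R Y) -> uniform_cellularity X K.
Proof.
move=> [f [g [fc gc fK gK]]].
have upper (J : Type) (G : J -> set X) : disjoint_family G -> inj_le J K.
  by move=> /(transfer_family gc fK X_rich Y_rich)[W Wd _]; exact: baire_family_le Wd.
have lower (U : set X) : open U -> U !=set0 ->
    exists2 G : K -> set X, disjoint_family G & forall k, G k `<=` U.
  move=> oU U0.
  (* The one-member family of [U] is carried to the space of branches, split there into [K] pieces,
     and carried back. *)
  have [|W [oW W0 _] WU] := transfer_family gc fK X_rich Y_rich (G := fun _ : unit => U).
    by split=> // -[] [].
  have [C Cd CW] := baire_family_ge (oW tt) (W0 tt).
  have [G [oG G0 Gd] GC] := transfer_family fc gK Y_rich X_rich Cd.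
  have GU k : remote_open (R := R) (G k) `<=` remote_open U.
    by move=> p /GC/(remote_openS (CW k))/WU; rewrite /= fK.
  (* The returning sets are inside [U] only as far as remote points can tell, hence the
     intersection; a trapped remote point shows it non-empty. *)
  exists (fun k => G k `&` U) => [|k x []//]; split.
  - by move=> k; exact: openI.
  - move=> k; apply: (@remote_open_meet R); have [p Gp] := X_rich (oG k) (G0 k).
    by exists p; split=> //; exact: GU Gp.
  - by move=> i j [x [[Gi _] [Gj _]]]; apply: Gd; exists x.
have X0 : [set: X] !=set0.
  have [|q _] := Y_rich (@openT Y); first by have [nu _] := Kinf; exists (fun=> nu 0%N).
  have pF := trace_proper (val (g q)).
  by have [x _] := filter_ex (@filterT _ (trace (val (g q))) _); exists x.
split=> [|U oU U0]; apply/has_cellularityP; split.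
- exact: upper.
- move=> L h; have [G Gd _] := lower _ openT X0; exact: h Gd.
- by move=> J G /(disjoint_family_val oU)/upper.
- move=> L h; have [G Gd GU] := lower _ oU U0.
  exact: h (disjoint_family_preimage GU Gd).
Qed.

Lemma uniform_cellularity_homeomorphic :
  uniform_cellularity X K -> homeomorphic (remote R X) (remote R Y).
Proof.
move=> [/has_cellularityP[upper lowerX] unif].
have lower (U : set X) (L : Type) : open U -> U !=set0 ->
    (forall (J : Type) (G : J -> set X), (forall j, G j `<=` U) ->
       disjoint_family G -> inj_le J L) -> inj_le K L.
  move=> oU U0 h; have /has_cellularityP[_ lowerU] := unif U oU U0.
  apply: lowerU => J G /(disjoint_family_val oU); apply: h => j _ [x _ <-].
  exact: set_valP.
have [nu _] := Kinf.
have X0 : [set: X] !=set0.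
  (* Over an empty space every disjoint family is empty, so [False] would bound the cellularity and
     [K] would be empty. *)
  apply: contrapT => nX; have [|F _] := lowerX False; last exact: (F (nu 0%N)).
  move=> J G [_ G0 _].
  have nJ : J -> False by move=> j; have [x _] := G0 j; apply: nX; exists x.
  by exists nJ => i; case: (nJ i).
have sep (U : set X) : open U -> U !=set0 -> separated_sequence d U.
  exact: nlc_separated.
have [V VT V0] := exists_full_tree dM Kinf upper lower sep X0.
apply: homeomorphic_sym.
have tc : continuous (tree_map dc VT V0) by exact: tree_map_continuous.
apply: (@remote_homeomorphic R _ _ _ tc).
- by move=> C; apply: tree_map_closed => //; exact: nu 0%N.
- by move=> x; apply: tree_map_surj => //; exact: nu 0%N.
- exact: tree_map_irreducible.
- exact: metric_normal dM.
- exact: baire_point_nwd.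
- by move=> x; exact: (nlc_point_nwd dM).
Qed.

End Main.

Theorem theorem5p4 (R : realType) (X : topologicalType) (K : choiceType)
    (X_nlc : nowhere_locally_compact X)
    (X_cmetr : completely_metrizable R X)
    (K_infinite : infinite_set [set: K]%classic) :
  homeomorphic (remote R X) (remote R (baire_space K)) <->
  uniform_cellularity X K.
Proof.
have /infinite_inj Kinf := K_infinite.
have [d dM dc] := completely_metrizable_metric X_cmetr.
split; first exact: (homeomorphic_uniform_cellularity dM).
exact: (uniform_cellularity_homeomorphic dM).
Qed.
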